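(* Let $d\ge 1$, $\vec q=(q(1),\dots,q(d))\in(0,\infty]^d$ and $K(1),\dots,K(d)\in(0,\infty)$. Put $K=\prod_{m=1}^d K(m)$ and $$M=M(d,\vec q)=\Big(\frac d2+\sum_{m=1}^d\frac1{q(m)}\Big)^{-1}\qquad(1/\infty:=0).$$ For $x>0$ let $S(\vec q,x)=\sup T(Q_d,x)$, where the supremum is taken over all $n\ge 1$, all $b\in B(d,n)$, and all families of martingale differences $\{\xi(i,m)\}$ (on any filtered probability space) satisfying $$\sup_i T(\xi(i,m),x)\le \exp\big(-(x/K(m))^{q(m)}\big)\quad\text{for all }x\ge 0,\ m=1,\dots,d. \tag{1.4}$$ Then there exist constants $C_1,C_2\in(0,\infty)$ and $x_0>0$, depending only on $d$ and $\vec q$, such that for all $x>x_0K$ $$\exp\Big(-\big[x/(C_1K)\big]^{M}\Big)\le S(\vec q,x)\le \exp\Big(-\big[x/(C_2K)\big]^{M}\Big).$$ Equivalently for the upper bound: $\|Q_d\|_{M}\le C_3(d,\vec q)\prod_{m=1}^d\sup_i\|\xi(i,m)\|_{q(m)}$ for all $b\in B(d,n)$.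
   Context: Martingale setting: $(\Omega,\mathcal F,\mathbf P)$ is a probability space with filtration $\mathcal F(0)\subset\mathcal F(1)\subset\cdots\subset\mathcal F$, $\mathcal F(0)=\{\emptyset,\Omega\}$. For $m=1,\dots,d$, $\{\xi(i,m)\}_{i\ge1}$ are martingale differences: $\xi(i,m)$ is $\mathcal F(i)$-measurable, integrable, and $\mathbf E[\xi(i,m)\mid\mathcal F(i-1)]=0$ a.s. (all $d$ sequences w.r.t. the same filtration). $I(d,n)=\{(i_1,\dots,i_d)\in\mathbb Z^d:1\le i_1<i_2<\dots<i_d\le n\}$; for $I=(i_1,\dots,i_d)$, $\xi(I)=\prod_{m=1}^d\xi(i_m,m)$; for a real array $b=(b(I))_{I\in I(d,n)}$, $Q_d=\sum_{I\in I(d,n)}b(I)\xi(I)$. $B(d,n)=\{b:\sum_{I\in I(d,n)}b(I)^2=1\}$. For a random variable $\tau$ and $x>0$, $T(\tau,x)=\max(\mathbf P(\tau>x),\mathbf P(\tau<-x))$. $|\eta|_p=(\mathbf E|\eta|^p)^{1/p}$. For $q\in(0,\infty]$, $\|\eta\|_q=\sup_{k\ge1 \text{ integer}}|\eta|_k\,k^{-1/q}$. *)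

(* Defs.v *)
From HB Require Import structures.
From mathcomp Require Import all_boot all_order all_algebra.
From mathcomp Require Import all_classical all_reals all_analysis.
Set Implicit Arguments. Unset Strict Implicit. Unset Printing Implicit Defensive.
Import Order.TTheory GRing.Theory Num.Theory.
Import numFieldNormedType.Exports.
Local Open Scope classical_set_scope.
Local Open Scope ring_scope.

Section Defs.
Variable R : realType.

Definition is_filtration {dd} {Om : measurableType dd} (F : nat -> set (set Om)) :=
  [/\ forall i, sigma_algebra setT (F i),
      forall i, F i `<=` measurable,
      forall i, F i `<=` F i.+1 &
      forall A, F 0%N A <-> (A = set0 \/ A = setT)].

Definition G_measurable {dd} {Om : measurableType dd} (G : set (set Om)) (X : Om -> R) :=
  forall B : set R, measurable B -> G (X @^-1` B).

(* martingale difference sequence (i >= 1) w.r.t. F: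
   xi i is F(i)-measurable, integrable, and E[xi i | F(i-1)] = 0 a.s.,
   the latter expressed by the defining property of conditional expectation:
   int_A xi i dP = 0 for all A in F(i-1). *)
Definition is_mart_diff {dd} {Om : measurableType dd} (P : probability Om R)
  (F : nat -> set (set Om)) (xi : nat -> Om -> R) :=
  forall i : nat, (1 <= i)%N ->
    [/\ G_measurable (F i) (xi i),
        P.-integrable setT (EFin \o xi i) &
        forall A, F i.-1 A -> (\int[P]_(w in A) (xi i w)%:E = 0)%E].

Definition Ttail {dd} {Om : measurableType dd} (P : probability Om R)
  (tau : Om -> R) (x : R) : \bar R :=
  maxe (P [set w | x < tau w]) (P [set w | tau w < - x]).

(* exp(-(x/K)^q), with the q = +oo case read as the limit: 1 if x <= K, 0 if x > K *)
Definition tailbd (q : \bar R) (K x : R) : R :=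
  match q with
  | r%:E => expR (- ((x / K) `^ r))
  | _ => if x <= K then 1 else 0
  end.

Definition invq (q : \bar R) : R :=
  match q with r%:E => r^-1 | _ => 0 end.

Definition Mexp (d : nat) (q : 'I_d -> \bar R) : R :=
  (d%:R / 2 + \sum_(m < d) invq (q m))^-1.

Definition prodK (d : nat) (K : 'I_d -> R) : R := \prod_(m < d) K m.

(* I(d,n): strictly increasing maps 'I_d -> 'I_n (index value j stands for j+1) *)
Definition incr_index (d n : nat) (I : {ffun 'I_d -> 'I_n}) : bool :=
  [forall i : 'I_d, forall j : 'I_d, (i < j)%N ==> (I i < I j)%N].

Definition in_B (d n : nat) (b : {ffun 'I_d -> 'I_n} -> R) :=
  \sum_(I | incr_index I) b I ^+ 2 = 1.

Definition Qd (d n : nat) {Om : Type} (b : {ffun 'I_d -> 'I_n} -> R)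
  (xi : nat -> 'I_d -> Om -> R) (w : Om) : R :=
  \sum_(I | incr_index I) b I * \prod_(m < d) xi (I m).+1 m w.

Definition Ssup (d : nat) (q : 'I_d -> \bar R) (K : 'I_d -> R) (x : R) : \bar R :=
  ereal_sup [set t : \bar R | exists (dd : measure_display) (Om : measurableType dd)
     (P : probability Om R) (F : nat -> set (set Om)) (xi : nat -> 'I_d -> Om -> R)
     (n : nat) (b : {ffun 'I_d -> 'I_n} -> R),
     [/\ is_filtration F /\ forall m, is_mart_diff P F (fun i => xi i m),
         forall m (i : nat) (y : R), (1 <= i)%N -> 0 <= y ->
            (Ttail P (xi i m) y <= (tailbd (q m) (K m) y)%:E)%E,
         (1 <= n)%N, in_B b &
         t = Ttail P (Qd b xi) x]].

End Defs.

(* Main.v *)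
Require Import Defs.
From HB Require Import structures.
From mathcomp Require Import all_boot all_order all_algebra.
From mathcomp Require Import all_classical all_reals all_analysis.
From mathcomp Require Import measurable_realfun.
From mathcomp Require Import ring lra.
Import Order.TTheory GRing.Theory Num.Theory.
Import numFieldNormedType.Exports HBNNSimple.
Local Open Scope classical_set_scope.
Local Open Scope ring_scope.

(** Upper bound.  If [S] and [X] satisfy [E (S ^ (2k-1) X) = 0], then the squared [L^2k]
    norms obey [|S + X|^2 <= |S|^2 + 5 k |X|^2].  Summing the martingale differences
    [xi(i,d) Q_(d-1)] over the last index [i = i_d], and separating the two factors by
    Cauchy-Schwarz, each of the [d] levels costs a factor [sqrt k] for the martingale and
    [k^(1/q(m))] for the moments of [xi(i,m)], so that [|Q_d|_(2k) <= C K k^(1/M)].  Markov's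
    inequality with [k] of order [(x / K)^M] concludes.

    Lower bound.  All the [xi(i,m)] are multiples [K(m) n^(1/q(m))] of one sequence of fair
    signs, switched on with probability [exp(-n)] and stopped at the first negative sign.
    With equal weights on [n = d l] steps, the event that all the signs are positive has
    probability at least [exp(-2n)], and [Q_d] is at least of order [K n^(1/M)] there; then
    [n] is chosen of order [(x / K)^M]. *)

(** * Elementary inequalities for even powers *)

Lemma bernoulli_ge (R : realType) (u : R) (k : nat) :
  0 <= u -> 1 + k%:R * u <= (1 + u) ^+ k.
Proof.
move=> u0; elim: k => [|k ih]; first by rewrite mul0r addr0 expr0.
rewrite exprS; apply: (@le_trans _ _ ((1 + u) * (1 + k%:R * u))).
  have : 0 <= k%:R * u * u by rewrite !mulr_ge0.
  by rewrite -natr1; nra.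
by rewrite ler_wpM2l// addr_ge0.
Qed.

Lemma expr1D_le_quadratic (R : realType) (t : R) (m : nat) :
  -1 <= t -> m%:R * `|t| <= 1 ->
  (1 + t) ^+ m <= 1 + m%:R * t + (m%:R * t) ^+ 2.
Proof.
move=> t1; elim: m => [|m ih] mt; first by rewrite expr0; nra.
have mt' : m%:R * `|t| <= 1.
  by apply: le_trans mt; rewrite ler_wpM2r// ler_nat.
have mle : m%:R * t <= 1 by apply: le_trans mt'; rewrite ler_wpM2l// ler_norm.
rewrite exprS; apply: (@le_trans _ _ ((1 + t) * (1 + m%:R * t + (m%:R * t) ^+ 2))).
  by rewrite ler_wpM2l ?ih//; lra.
have m0 : 0 <= m%:R :> R by [].
(* The target exceeds the expanded product by [t ^ 2 + m t ^ 2 (1 - m t)]. *)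
have : 0 <= (m%:R * t ^+ 2) * (1 - m%:R * t).
  by apply: mulr_ge0; [rewrite mulr_ge0 ?sqr_ge0|rewrite subr_ge0].
have t20 := sqr_ge0 t.
by rewrite -natr1; nra.
Qed.

(** When [2 K |t| <= 1], a second-order expansion is enough, its square [(2 K t) ^ 2] being covered
    by Bernoulli's inequality. For larger [|t|] the linear term is itself at most [(2 K t) ^ 2] in
    size: for [t > 0] the bases [(1 + t) ^ 2] and [1 + 5 K t ^ 2] compare directly, for
    [-2 <= t < 0] the left side is at most [1], and for [t < -2] it is at most [t ^ (2 K)]. The
    constant [5] leaves room for [4 K + 1 <= 5 K]. *)
Lemma expr1D_even_le (R : realType) (t : R) (k : nat) :
  (1 + t) ^+ k.+1.*2 <=
  k.+1.*2%:R * t + (1 + 5 * k.+1%:R * t ^+ 2) ^+ k.+1.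
Proof.
set K : R := k.+1%:R.
have K1 : 1 <= K by rewrite ler1n.
have t20 := sqr_ge0 t.
have K0 : 0 <= K by [].
have Kt := mulr_ge0 K0 t20.
have K2 : k.+1.*2%:R = 2 * K :> R by rewrite -muln2 natrM mulrC.
have bern4 : 1 + 4 * K ^+ 2 * t ^+ 2 <= (1 + 5 * K * t ^+ 2) ^+ k.+1.
  have u0 : 0 <= 5 * K * t ^+ 2 by lra.
  apply: le_trans (bernoulli_ge _ _ k.+1 u0).
  by rewrite -/K; have := mulr_ge0 (sqr_ge0 K) t20; nra.
have evenE u : u ^+ k.+1.*2 = (u ^+ 2) ^+ k.+1 by rewrite -exprM mul2n.
have [small|large] := lerP (2 * K * `|t|) 1.
  have tb : -1 <= t by have := ler_norm (- t); rewrite normrN; nra.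
  have : k.+1.*2%:R * `|t| <= 1 by rewrite K2.
  by move/(expr1D_le_quadratic _ _ _ tb); rewrite K2; nra.
have [t0|t0] := lerP 0 t.
  rewrite ger0_norm// in large.
  rewrite -[leLHS]add0r; apply: lerD; first exact: mulr_ge0.
  rewrite evenE; apply: lerXn2r; rewrite ?nnegrE ?sqr_ge0//; first by lra.
  have : 0 <= t * (2 * K * t - 1) by rewrite mulr_ge0// subr_ge0 ltW.
  by nra.
rewrite ltr0_norm// in large.
have mt : - (2 * K * t) <= 4 * K ^+ 2 * t ^+ 2.
  have : 0 <= (- (2 * K * t)) * (- (2 * K * t) - 1).
    by apply: mulr_ge0; nra.
  by nra.
have [t2|t2] := lerP (-2) t.
  have : (1 + t) ^+ k.+1.*2 <= 1.
    by rewrite evenE exprn_ile1 ?sqr_ge0//; nra.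
  by rewrite K2; lra.
have h1 : (1 + t) ^+ k.+1.*2 <= (t ^+ 2) ^+ k.+1.
  by rewrite evenE lerXn2r ?nnegrE ?sqr_ge0//; nra.
have t1 : 1 <= t ^+ 2 by nra.
have h2 : (t ^+ 2 * (1 + 4 * K)) ^+ k.+1 <= (1 + 5 * K * t ^+ 2) ^+ k.+1.
  rewrite lerXn2r ?nnegrE//.
  - by apply: mulr_ge0 => //; lra.
  - by lra.
  - have : 0 <= (K - 1) * t ^+ 2 by apply: mulr_ge0 => //; lra.
    by nra.
apply: le_trans (lerD _ h2); last exact: lexx.
rewrite exprMn; apply: le_trans h1 _.
(* Bernoulli with [u = 4 K] leaves [V + 4 K ^ 2 V] on the right: [V] is the left side, and
   [4 K ^ 2 V >= 4 K ^ 2 t ^ 2] outweighs the negative term [2 K t]. *)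
have := bernoulli_ge _ (4 * K) k.+1 (mulr_ge0 (ler0n _ 4) K0).
rewrite -/K => h3.
have h4 : t ^+ 2 <= (t ^+ 2) ^+ k.+1 by rewrite ler_eXnr.
set V := (t ^+ 2) ^+ k.+1 in h4 *.
have : V * (1 + K * (4 * K)) <= V * (1 + 4 * K) ^+ k.+1.
  by rewrite ler_wpM2l// (le_trans _ h4).
have : t ^+ 2 * (4 * K ^+ 2) <= V * (4 * K ^+ 2).
  by rewrite ler_wpM2r//; apply: mulr_ge0; rewrite ?sqr_ge0.
have : 0 <= (t ^+ 2) * (4 * K ^+ 2 - 2 * K) + 2 * K * (t ^+ 2 + t).
  by apply: addr_ge0; apply: mulr_ge0 => //; nra.
by rewrite K2; nra.
Qed.

(* The only inequality about even powers the argument needs: all odd-order terms but the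
   linear one, which has mean zero for martingales, are absorbed by [5 k x ^ 2]. *)
Lemma exprD_even_le (R : realType) (s x : R) (k : nat) :
  (s + x) ^+ k.+1.*2 <=
  k.+1.*2%:R * (s ^+ k.*2.+1 * x) + (s ^+ 2 + 5 * k.+1%:R * x ^+ 2) ^+ k.+1.
Proof.
have [->|s0] := eqVneq s 0.
  rewrite add0r expr0n/= mul0r mulr0 add0r expr0n/= add0r -mul2n exprM.
  have x20 := sqr_ge0 x.
  have : 1 <= k.+1%:R :> R by rewrite ler1n.
  by move=> k1; apply: lerXn2r; rewrite ?nnegrE//; nra.
have -> : x = s * (x / s) by rewrite mulrC divfK.
set t := x / s; rewrite -{1}(mulr1 s) -mulrDr exprMn.
have -> : s ^+ 2 + 5 * k.+1%:R * (s * t) ^+ 2 =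
  s ^+ 2 * (1 + 5 * k.+1%:R * t ^+ 2) by ring.
rewrite exprMn -exprM mul2n.
rewrite (_ : k.+1.*2%:R * _ = s ^+ k.+1.*2 * (k.+1.*2%:R * t)); last first.
  by rewrite doubleS [in RHS]exprSr; ring.
rewrite -mulrDr ler_wpM2l ?expr1D_even_le//.
by rewrite -mul2n exprM exprn_ge0// sqr_ge0.
Qed.

(** Jensen's inequality for the power [k.+1] with unnormalised weights. The induction step is
    Chebyshev's sum inequality: [U, V] and [u, v] are ordered alike. *)
Lemma expr_weighted_mean_le (R : realType) (a b u v : R) (k : nat) :
  0 <= a -> 0 <= b -> 0 <= u -> 0 <= v ->
  (a * u + b * v) ^+ k.+1 <= (a + b) ^+ k * (a * u ^+ k.+1 + b * v ^+ k.+1).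
Proof.
move=> a0 b0 u0 v0; elim: k => [|k ih]; first by rewrite expr0 !expr1 mul1r.
rewrite exprS.
apply: (@le_trans _ _ ((a * u + b * v) *
    ((a + b) ^+ k * (a * u ^+ k.+1 + b * v ^+ k.+1)))).
  by rewrite ler_wpM2l// addr_ge0// mulr_ge0.
rewrite (exprSr (a + b)) mulrCA -mulrA ler_wpM2l ?exprn_ge0 ?addr_ge0//.
rewrite !(exprS _ k.+1).
have : 0 <= (u ^+ k.+1 - v ^+ k.+1) * (u - v).
  have [uv|/ltW uv] := lerP u v; [apply: mulr_le0|apply: mulr_ge0];
    by rewrite ?subr_le0 ?subr_ge0 ?lerXn2r ?nnegrE.
set U := u ^+ k.+1; set V := v ^+ k.+1 => h.
have : 0 <= a * b * ((U - V) * (u - v)) := mulr_ge0 (mulr_ge0 a0 b0) h.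
by nra.
Qed.

(** * Filtrations and measurability with respect to a sub-sigma-algebra *)

Lemma filtration_le (dd : measure_display) (Om : measurableType dd)
    (F : nat -> set (set Om)) i j : is_filtration F -> (i <= j)%N -> F i `<=` F j.
Proof.
move=> [_ _ Fi _]; elim: j => [|j ih]; first by rewrite leqn0 => /eqP ->.
rewrite leq_eqVlt => /orP[/eqP -> A //|]; rewrite ltnS => /ih.
by move=> ij A /ij; exact: Fi.
Qed.

Section G_measurable.
Context {R : realType} {dd : measure_display} {Om : measurableType dd}.
Variable G : set (set Om).
Hypothesis sG : sigma_algebra setT G.
Implicit Types X Y : Om -> R.

(** As [G] equals the sigma-algebra it generates, the closure properties below are inherited from
    ordinary measurable functions. *)
Lemma G_measurableP X :
  G_measurable G X <-> measurable_fun setT (X : g_sigma_algebraType G -> R).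
Proof.
have mE A : measurable (A : set (g_sigma_algebraType G)) <-> G A.
  by rewrite /measurable/= sigma_algebra_id.
split=> [GX _ B mB | mX B mB]; first by rewrite setTI mE; exact: GX.
by apply/mE; have := mX measurableT _ mB; rewrite setTI.
Qed.

Lemma G_measurableM X Y :
  G_measurable G X -> G_measurable G Y -> G_measurable G (fun w => X w * Y w).
Proof.
by move=> /G_measurableP mX /G_measurableP mY; apply/G_measurableP; exact: measurable_funM.
Qed.

Lemma G_measurableX X n : G_measurable G X -> G_measurable G (fun w => X w ^+ n).
Proof.
by move=> /G_measurableP mX; apply/G_measurableP; exact: measurable_funX.
Qed.

Lemma G_measurable_cst (c : R) : G_measurable G (fun=> c).
Proof. by apply/G_measurableP; exact: measurable_cst. Qed.

Lemma G_measurable_sum (I : Type) (s : seq I) (X : I -> Om -> R) :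
  (forall i, G_measurable G (X i)) ->
  G_measurable G (fun w => \sum_(i <- s) X i w).
Proof.
by move=> mX; apply/G_measurableP/measurable_sum => i; exact/G_measurableP.
Qed.

Lemma G_measurable_prod (I : finType) (X : I -> Om -> R) :
  (forall i, G_measurable G (X i)) ->
  G_measurable G (fun w => \prod_i X i w).
Proof.
by move=> mX; apply/G_measurableP/measurable_prod => i _; exact/G_measurableP.
Qed.

End G_measurable.

(** * Orthogonality of a martingale difference to the past *)

Section conditionally_centered.
Context {R : realType} {dd : measure_display} {Om : measurableType dd}.
Variable P : probability Om R.
Implicit Types X Y : Om -> R.

Lemma G_measurable_measurable (G : set (set Om)) X :
  (G `<=` measurable)%classic -> G_measurable G X -> measurable_fun setT X.
Proof. by move=> Gm GX _ B mB; rewrite setTI; apply: Gm; exact: GX. Qed.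

(** The working form of [E[X | G] = 0]: orthogonality to all [G]-measurable factors with integrable
    product, instead of indicators only. *)
Definition centered_given (G : set (set Om)) X := forall Y, G_measurable G Y ->
  P.-integrable setT (fun w => (Y w * X w)%:E) -> (\int[P]_w (Y w * X w)%:E = 0)%E.

Variable G : set (set Om).
Hypothesis (sG : sigma_algebra setT G) (Gm : (G `<=` measurable)%classic).
Variable X : Om -> R.
Hypothesis iX : P.-integrable setT (EFin \o X).
Hypothesis X0 : forall A, G A -> (\int[P]_(w in A) (X w)%:E = 0)%E.

Let mX : measurable_fun setT X.
Proof. by apply/measurable_EFinP; case/integrableP: iX. Qed.

(** A simple function of [Y] is a finite combination of indicators of sets of [G], and [X]
    integrates to zero over each of them. *)
Lemma integral_nnsfun_mul_eq0 Y (h : {nnsfun R >-> R}) : G_measurable G Y ->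
  (\int[P]_w (h (Y w) * X w)%:E = 0)%E.
Proof.
move=> GY; set A := (fun c : R => Y @^-1` (h @^-1` [set c]))%classic.
have GA c : G (A c) by apply: GY; exact: measurable_sfunP.
have mA c := Gm _ (GA c).
have iXA c : P.-integrable setT (fun w => ((X w) * \1_(A c) w)%:E).
  have -> : (fun w => ((X w) * \1_(A c) w)%:E) = ((EFin \o X) \_ (A c))%classic.
    by rewrite restrict_EFin patch_indic.
  apply/(integrable_mkcond _ (mA c)); exact: integrableS iX.
transitivity (\int[P]_w (\sum_(c <- finmap.enum_fset (fset_set (range h)))
    (c%:E * ((X w) * \1_(A c) w)%:E)))%E.
  apply: eq_integral => w _; rewrite fimfunE fsbig_finite//= mulr_suml -sumEFin.
  apply: eq_bigr => c _; rewrite -EFinM; congr (_%:E).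
  by rewrite -mulrA (mulrC (X w)).
rewrite integral_sum//; last by move=> c; exact: integrableZl.
rewrite big1// => c _; rewrite integralZl//.
suff -> : (\int[P]_w (X w * \1_(A c) w)%:E = \int[P]_(w in A c) (X w)%:E)%E.
  by rewrite X0 ?mule0.
rewrite [RHS]integral_mkcond; apply: eq_integral => w _.
by rewrite (restrict_EFin X) /= patch_indic.
Qed.

(** The simple approximations are taken on the real line and then composed with [Y], so that the
    previous lemma applies to them. They stay below [f], whence dominated convergence with bound
    [|f(Y) X|]. *)
Lemma integral_ge0_mul_eq0 Y (f : R -> R) : G_measurable G Y ->
  measurable_fun setT f -> (forall y, 0 <= f y) ->
  P.-integrable setT (fun w => (f (Y w) * X w)%:E) ->
  (\int[P]_w (f (Y w) * X w)%:E = 0)%E.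
Proof.
move=> GY mf f0 iYX.
have mY := G_measurable_measurable _ _ Gm GY.
have mfE : measurable_fun setT (EFin \o f) by exact/measurable_EFinP.
pose h := nnsfun_approx measurableT mfE.
have f0E y : setT y -> (0 <= (EFin \o f) y)%E by rewrite lee_fin.
have hf n y : h n y <= f y.
  rewrite -lee_fin nnsfun_approxE; exact: le_approx.
have hcvg y : (h ^~ y @ \oo --> f y)%classic.
  exact: (fine_cvg (cvg_nnsfun_approx measurableT mfE f0E (I : setT y))).
have [] := @dominated_convergence _ _ _ P setT measurableT
  (fun n w => (h n (Y w) * X w)%:E) (fun w => (f (Y w) * X w)%:E)
  (fun w => `|(f (Y w) * X w)%:E|)%E.
- move=> n; apply/measurable_EFinP; apply: measurable_funM => //.
  exact: measurableT_comp.
- by case/integrableP: iYX.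
- apply/aeW => w _; apply: cvg_EFin; first by near=> n.
  by apply: cvgMl; exact: hcvg.
- exact: integrable_abse.
- apply/aeW => w n _; rewrite lee_fin !normrM ler_wpM2r//.
  by rewrite !ger0_norm.
move=> _ _ /cvg_lim <-//; apply: lim_near_cst => //.
by near=> n; rewrite /= integral_nnsfun_mul_eq0.
Unshelve. all: by end_near. Qed.

(** Positive and negative parts of [Y] are treated separately; both products are dominated by
    [|Y X|], hence integrable. *)
Lemma centered_givenP : centered_given G X.
Proof.
move=> Y GY iYX.
have mY := G_measurable_measurable _ _ Gm GY.
have mposY : measurable_fun setT (fun y : R => Num.max y 0).
  by apply: measurable_maxr.
have mnegY : measurable_fun setT (fun y : R => Num.max (- y) 0).
  by apply: measurable_maxr => //; exact: measurableT_comp.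
have ipos : P.-integrable setT (fun w => (Num.max (Y w) 0 * X w)%:E).
  apply: le_integrable iYX => //.
    apply/measurable_EFinP/measurable_funM => //.
    by apply: (measurableT_comp mposY).
  move=> w _; rewrite lee_fin !normrM ler_wpM2r//.
  by have [] := lerP (Y w) 0; rewrite ?normr0.
have ineg : P.-integrable setT (fun w => (Num.max (- Y w) 0 * X w)%:E).
  apply: le_integrable iYX => //.
    apply/measurable_EFinP/measurable_funM => //.
    by apply: (measurableT_comp mnegY).
  move=> w _; rewrite lee_fin !normrM ler_wpM2r//.
  by have [] := lerP (- Y w) 0; rewrite ?normr0 ?normrN.
transitivity (\int[P]_w ((Num.max (Y w) 0 * X w)%:E - (Num.max (- Y w) 0 * X w)%:E))%E.
  apply: eq_integral => w _; rewrite -EFinB -mulrBl; congr ((_ * _)%:E).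
  by case: (lerP (Y w)); case: (lerP (- Y w)); lra.
rewrite integralB//.
rewrite (integral_ge0_mul_eq0 _ _ GY mposY)//; last by move=> y; rewrite le_max lexx orbT.
rewrite (integral_ge0_mul_eq0 _ _ GY mnegY)//; last by move=> y; rewrite le_max lexx orbT.
by rewrite sube0.
Qed.

End conditionally_centered.

(** * Even moments of sums, products and martingales *)

Section even_moments.
Context {R : realType} {dd : measure_display} {Om : measurableType dd}.
Variable P : probability Om R.
Implicit Types S X Y : Om -> R.

Lemma expr_double_ge0 (x : R) n : 0 <= x ^+ n.*2.
Proof. by rewrite -mul2n exprM exprn_ge0// sqr_ge0. Qed.

Lemma integrable_le_fin (f : Om -> R) (r : R) : measurable_fun setT f ->
  (forall w, 0 <= f w) -> (\int[P]_w (f w)%:E <= r%:E)%E ->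
  P.-integrable setT (EFin \o f).
Proof.
move=> mf f0 fr; apply/integrableP; split; first exact/measurable_EFinP.
under eq_integral do rewrite /= ger0_norm//.
by rewrite (le_lt_trans fr)// ltry.
Qed.

(** A crude form of Young's inequality, used to make the mixed term of [even_moment_add]
    integrable. *)
Lemma norm_exprM_le (s x : R) n : `|s ^+ n * x| <= `|s| ^+ n.+1 + `|x| ^+ n.+1.
Proof.
rewrite normrM normrX; have s0 := normr_ge0 s; have x0 := normr_ge0 x.
have [sx|/ltW xs] := lerP `|s| `|x|.
  apply: (@le_trans _ _ (`|x| ^+ n * `|x|)).
    by rewrite ler_wpM2r// lerXn2r.
  by rewrite -exprSr lerDr exprn_ge0.
apply: (@le_trans _ _ (`|s| ^+ n * `|s|)).
  by rewrite ler_wpM2l// exprn_ge0.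
by rewrite -exprSr lerDl exprn_ge0.
Qed.

(** After integration of [exprD_even_le] the linear term drops out. What remains is Minkowski's
    inequality in [L^(k+1)] for [S ^ 2] and [5 k.+1 X ^ 2], obtained pointwise from Jensen's
    inequality with weights [a] and [c]. *)
Lemma even_moment_add S X k (a b : R) :
  measurable_fun setT S -> measurable_fun setT X -> 0 < a -> 0 < b ->
  (\int[P]_w (S w ^+ k.+1.*2)%:E <= (a ^+ k.+1)%:E)%E ->
  (\int[P]_w (X w ^+ k.+1.*2)%:E <= (b ^+ k.+1)%:E)%E ->
  (P.-integrable setT (fun w => (S w ^+ k.*2.+1 * X w)%:E) ->
   \int[P]_w (S w ^+ k.*2.+1 * X w)%:E = 0)%E ->
  (\int[P]_w ((S w + X w) ^+ k.+1.*2)%:E <= ((a + 5 * k.+1%:R * b) ^+ k.+1)%:E)%E.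
Proof.
move=> mS mX a0 b0 hS hX hSX.
have mS2 : measurable_fun setT (fun w => S w ^+ k.+1.*2) by exact: measurable_funX.
have mX2 : measurable_fun setT (fun w => X w ^+ k.+1.*2) by exact: measurable_funX.
have iS := integrable_le_fin _ _ mS2 (fun w => expr_double_ge0 (S w) _) hS.
have iX := integrable_le_fin _ _ mX2 (fun w => expr_double_ge0 (X w) _) hX.
have iSX : P.-integrable setT (fun w => (S w ^+ k.*2.+1 * X w)%:E).
  apply: (le_integrable _ _ _ (integrableD measurableT iS iX)) => //.
    by apply/measurable_EFinP/measurable_funM => //; exact: measurable_funX.
  move=> w _; rewrite -EFinD lee_fin /= (le_trans (norm_exprM_le _ _ _))//.
  by rewrite -!normrX -doubleS ger0_norm ?expr_double_ge0// ger0_norm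
    ?expr_double_ge0// ler_norm.
set c := 5 * k.+1%:R * b.
have c0 : 0 < c by rewrite !mulr_gt0.
(* Coefficients produced by Jensen on [a (S ^ 2 / a) + c (X ^ 2 / b)]. Against the moment bounds
   they give [(a + c) ^ k a] and [(a + c) ^ k c], which add up to [(a + c) ^ k.+1]. *)
set al := (a + c) ^+ k * a / a ^+ k.+1.
set be := (a + c) ^+ k * c / b ^+ k.+1.
have ac0 : 0 <= (a + c) ^+ k by rewrite exprn_ge0// addr_ge0 ?ltW.
have al0 : 0 <= al by apply: divr_ge0; [apply: mulr_ge0|apply: exprn_ge0] => //; exact: ltW.
have be0 : 0 <= be by apply: divr_ge0; [apply: mulr_ge0|apply: exprn_ge0] => //; exact: ltW.
have key w : (S w + X w) ^+ k.+1.*2 <= k.+1.*2%:R * (S w ^+ k.*2.+1 * X w) +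
    (al * S w ^+ k.+1.*2 + be * X w ^+ k.+1.*2).
  apply: le_trans (exprD_even_le _ _ _ _) _; rewrite lerD2l.
  have -> : S w ^+ 2 + 5 * k.+1%:R * X w ^+ 2 = a * (S w ^+ 2 / a) + c * (X w ^+ 2 / b).
    by rewrite /c; field; rewrite !gt_eqF.
  apply: le_trans (expr_weighted_mean_le _ _ _ _ _ k (ltW a0) (ltW c0)
    (divr_ge0 (sqr_ge0 _) (ltW a0)) (divr_ge0 (sqr_ge0 _) (ltW b0))) _.
  rewrite !expr_div_n -!exprM !mul2n /al /be le_eqVlt; apply/orP; left; apply/eqP.
  by field; rewrite !gt_eqF ?exprn_gt0.
have i1 := integrableZl measurableT k.+1.*2%:R iSX.
have i2 := integrableZl measurableT al iS.
have i3 := integrableZl measurableT be iX.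
have i23 := integrableD measurableT i2 i3.
have i123 := integrableD measurableT i1 i23.
apply: (@le_trans _ _ (\int[P]_w (k.+1.*2%:R%:E * (S w ^+ k.*2.+1 * X w)%:E +
    (al%:E * (S w ^+ k.+1.*2)%:E + be%:E * (X w ^+ k.+1.*2)%:E)))%E).
  apply: ge0_le_integral => //.
  - by move=> w _; rewrite lee_fin expr_double_ge0.
  - by apply/measurable_EFinP/measurable_funX/measurable_funD.
  - by case/integrableP: i123.
  - by move=> w _; rewrite -!EFinM -!EFinD lee_fin key.
rewrite (integralD measurableT i1 i23) (integralD measurableT i2 i3).
rewrite !integralZl// hSX// mule0 add0e.
apply: (@le_trans _ _ (al%:E * (a ^+ k.+1)%:E + be%:E * (b ^+ k.+1)%:E)%E).
  by apply: leeD; apply: lee_wpmul2l => //; rewrite lee_fin.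
rewrite -!EFinM -EFinD lee_fin /al /be !divfK ?gt_eqF ?exprn_gt0//.
by rewrite -mulrDr -exprSr.
Qed.

(** Cauchy-Schwarz through the pointwise inequality between [x y] and [al x ^ 2 + be y ^ 2]; the
    scaling is such that the bounds [A ^ 2] and [B ^ 2] each contribute [A B / 2]. *)
Lemma even_moment_mul X Y k (a b : R) :
  measurable_fun setT X -> measurable_fun setT Y -> 0 < a -> 0 < b ->
  (\int[P]_w (X w ^+ k.+1.*2.*2)%:E <= (a ^+ k.+1.*2)%:E)%E ->
  (\int[P]_w (Y w ^+ k.+1.*2.*2)%:E <= (b ^+ k.+1.*2)%:E)%E ->
  (\int[P]_w ((X w * Y w) ^+ k.+1.*2)%:E <= ((a * b) ^+ k.+1)%:E)%E.
Proof.
move=> mX mY a0 b0 hX hY.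
set m := k.+1.*2.
have mX2 : measurable_fun setT (fun w => X w ^+ m.*2) by exact: measurable_funX.
have mY2 : measurable_fun setT (fun w => Y w ^+ m.*2) by exact: measurable_funX.
have iX := integrable_le_fin _ _ mX2 (fun w => expr_double_ge0 (X w) _) hX.
have iY := integrable_le_fin _ _ mY2 (fun w => expr_double_ge0 (Y w) _) hY.
set A := a ^+ k.+1; set B := b ^+ k.+1.
have A0 : 0 < A by rewrite exprn_gt0.
have B0 : 0 < B by rewrite exprn_gt0.
pose al := A * B / (2 * A ^+ 2); pose be := A * B / (2 * B ^+ 2).
have al0 : 0 <= al.
  by apply: divr_ge0; apply: mulr_ge0; rewrite ?sqr_ge0// ltW.
have be0 : 0 <= be.
  by apply: divr_ge0; apply: mulr_ge0; rewrite ?sqr_ge0// ltW.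
have AE : a ^+ m = A ^+ 2 by rewrite -exprM muln2.
have BE : b ^+ m = B ^+ 2 by rewrite -exprM muln2.
have key w : (X w * Y w) ^+ m <= al * X w ^+ m.*2 + be * Y w ^+ m.*2.
  rewrite exprMn -(muln2 m) !exprM.
  have := mulr_ge0 (mulr_ge0 (ltW A0) (ltW B0)) (sqr_ge0 (X w ^+ m / A - Y w ^+ m / B)).
  set x := X w ^+ m; set y := Y w ^+ m.
  have -> : A * B * (x / A - y / B) ^+ 2 = 2 * (al * x ^+ 2 + be * y ^+ 2 - x * y).
    by rewrite /al /be; field; rewrite !gt_eqF.
  lra.
have i2 := integrableZl measurableT al iX.
have i3 := integrableZl measurableT be iY.
have i23 := integrableD measurableT i2 i3.
apply: (@le_trans _ _ (\int[P]_w (al%:E * (X w ^+ m.*2)%:E + be%:E * (Y w ^+ m.*2)%:E))%E).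
  apply: ge0_le_integral => //.
  - by move=> w _; rewrite lee_fin expr_double_ge0.
  - by apply/measurable_EFinP/measurable_funX/measurable_funM.
  - by case/integrableP: i23.
  - by move=> w _; rewrite -!EFinM -!EFinD lee_fin key.
rewrite (integralD measurableT i2 i3) !integralZl//.
apply: (@le_trans _ _ (al%:E * (a ^+ m)%:E + be%:E * (b ^+ m)%:E)%E).
  by apply: leeD; apply: lee_wpmul2l => //; rewrite lee_fin.
rewrite -!EFinM -EFinD lee_fin AE BE exprMn -/A -/B /al /be.
by rewrite le_eqVlt; apply/orP; left; apply/eqP; field; rewrite !gt_eqF.
Qed.

(* The slack [a] keeps every intermediate bound positive, as [even_moment_add] requires. *)
Lemma even_moment_martingale (F : nat -> set (set Om)) (X : nat -> Om -> R)
    (s : nat -> R) (a : R) k n :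
  is_filtration F -> 0 < a -> (forall i, (i < n)%N -> 0 < s i) ->
  (forall i, (i < n)%N -> G_measurable (F i.+1) (X i)) ->
  (forall i, (i < n)%N -> centered_given P (F i) (X i)) ->
  (forall i, (i < n)%N ->
    (\int[P]_w (X i w ^+ k.+1.*2)%:E <= (s i ^+ k.+1)%:E)%E) ->
  (\int[P]_w ((\sum_(i < n) X i w) ^+ k.+1.*2)%:E <=
    ((a + 5 * k.+1%:R * \sum_(i < n) s i) ^+ k.+1)%:E)%E.
Proof.
move=> fF a0; have [sF Fm _ _] := fF.
elim: n => [|n ih] s0 FX cX hX.
  under eq_integral do rewrite big_ord0 doubleS expr0n/=.
  by rewrite integral0 lee_fin exprn_ge0// big_ord0 mulr0 addr0 ltW.
(* [X i] is the increment from time [i] to time [i.+1], so the sum of the first [n] terms is known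
   at time [n], and its odd powers are admissible factors for [X n]. *)
have FS : G_measurable (F n) (fun w => \sum_(i < n) X i w).
  apply: G_measurable_sum => // i B mB; apply: (filtration_le _ _ F i.+1 n) => //.
  by apply: FX => //; rewrite ltnS ltnW.
rewrite big_ord_recr/= mulrDr addrA.
under eq_integral do rewrite big_ord_recr/=.
apply: even_moment_add.
- exact: G_measurable_measurable (Fm n) FS.
- exact: G_measurable_measurable (Fm n.+1) (FX n (ltnSn n)).
- rewrite ltr_wpDr// mulr_ge0//; apply: sumr_ge0 => i _.
  by rewrite ltW// s0// ltnS ltnW.
- exact: s0.
- by apply: ih => i /ltnW ni; [apply: s0|apply: FX|apply: cX|apply: hX].
- exact: hX.
- by apply: cX => //; exact: G_measurableX.
Qed.

End even_moments.

(** * From tail bounds to even moments *)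

Section tail_moments.
Context {R : realType} {dd : measure_display} {Om : measurableType dd}.
Variable P : probability Om R.
Implicit Types X : Om -> R.

Lemma measurable_gt X (t : R) :
  measurable_fun setT X -> measurable [set w | t < X w].
Proof.
move=> mX; rewrite (_ : [set w | _] = X @^-1` `]t, +oo[)%classic.
  by rewrite -[X in measurable X]setTI; exact: mX.
by apply/seteqP; split=> w /=; rewrite in_itv/= andbT.
Qed.

Lemma measurable_lt X (t : R) :
  measurable_fun setT X -> measurable [set w | X w < t].
Proof.
move=> mX; rewrite (_ : [set w | _] = X @^-1` `]-oo, t[)%classic.
  by rewrite -[X in measurable X]setTI; exact: mX.
by apply/seteqP; split=> w /=; rewrite in_itv.
Qed.

(** Dyadic decomposition: [X] is at most [1] plus the sum of [2 ^ j] over the levels [2 ^ j] that it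
    exceeds. Level [j] contributes at most [2 ^ j * 2 / 4 ^ j], and these terms sum to [4]. *)
Lemma integral_le5_of_tail X : measurable_fun setT X -> (forall w, 0 <= X w) ->
  (forall t, 1 <= t -> (P [set w | (t < X w)%R] <= (2 / t ^+ 2)%:E)%E) ->
  (\int[P]_w (X w)%:E <= 5%:E)%E.
Proof.
move=> mX X0 tX.
pose A j := [set w | 2 ^+ j < X w].
have mA j : measurable (A j) by exact: measurable_gt.
pose f j w : \bar R := (2 ^+ j * \1_(A j) w)%:E.
have f0 j w : (0 <= f j w)%E by rewrite lee_fin mulr_ge0// exprn_ge0.
have mf j : measurable_fun setT (f j).
  by apply/measurable_EFinP/measurable_funM => //; exact: measurable_indic.
have trunc N w : Num.min (X w) (2 ^+ N) <= 1 + \sum_(j < N) 2 ^+ j * \1_(A j) w.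
  elim: N => [|N ih]; first by rewrite big_ord0 addr0 expr0 ge_min lexx orbT.
  rewrite big_ord_recr/= addrA indicE.
  have [XN|NX] := lerP (X w) (2 ^+ N).
    rewrite memNset ?mulr0 ?addr0; last by rewrite /A/= => /lt_geF; rewrite XN.
    by apply: le_trans ih; rewrite [leRHS]min_l// ge_min lexx.
  rewrite mem_set// mulr1; rewrite min_r ?(ltW NX)// in ih.
  by rewrite ge_min exprS (_ : 2 * 2 ^+ N = 2 ^+ N + 2 ^+ N) ?lerD ?orbT// mulr_natl.
have Xle w : ((X w)%:E <= 1%:E + \sum_(j <oo) f j w)%E.
  have [N XN] : exists N, X w <= 2 ^+ N.
    exists (Num.bound (X w)); rewrite (le_trans (ltW (archi_boundP (X0 w))))//.
    by rewrite -natrX ler_nat ltnW// ltn_expl.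
  have := trunc N w; rewrite min_l// => h.
  apply: (@le_trans _ _ (1%:E + \sum_(j < N) f j w)%E).
    by rewrite sumEFin -EFinD lee_fin.
  by rewrite leeD2l// -(big_mkord xpredT (f ^~ w)); exact: nneseries_lim_ge.
apply: (@le_trans _ _ (\int[P]_w (1%:E + \sum_(j <oo) f j w))%E).
  apply: ge0_le_integral => //.
  - by move=> w _; rewrite lee_fin.
  - exact/measurable_EFinP.
  - apply: emeasurable_funD => //; apply: ge0_emeasurable_sum => //.
rewrite ge0_integralD//; last 2 first.
- by move=> w _; apply: nneseries_ge0.
- by apply: ge0_emeasurable_sum.
rewrite integral_cst// [X in (_ * X)%E]probability_setT mule1 integral_nneseries//.
rewrite (_ : 5 = 1 + 4); last by ring.
rewrite EFinD leeD2l//.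
have hcvg := @cvg_geometric_eseries_half R 4 0.
rewrite expr0 divr1 in hcvg.
rewrite -(cvg_lim _ hcvg)//; apply: lee_nneseries => [j _ _|j _].
  by apply: integral_ge0 => w _.
have -> : (\int[P]_w f j w = (2 ^+ j)%:E * P (A j))%E.
  rewrite (_ : f j = fun w => ((2 ^+ j)%:E * (\1_(A j) w)%:E)%E)//.
  rewrite ge0_integralZl_EFin//.
    by rewrite integral_indic// setIT.
  exact/measurable_EFinP/measurable_indic.
apply: (@le_trans _ _ ((2 ^+ j)%:E * (2 / (2 ^+ j) ^+ 2)%:E)%E).
  by apply: lee_wpmul2l; [rewrite lee_fin exprn_ge0|apply: tX; rewrite exprn_ege1// ler1n].
rewrite -EFinM lee_fin natrX addn1 (exprS 2 j).
have : 0 < 2 ^+ j :> R by rewrite exprn_gt0.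
set z := 2 ^+ j => z0; rewrite le_eqVlt; apply/orP; left; apply/eqP.
by field; rewrite gt_eqF.
Qed.

Lemma abs_tail_le X (y : R) (t : R) : measurable_fun setT X ->
  (Ttail P X y <= t%:E)%E -> (P [set w | (y < `|X w|)%R] <= (2 * t)%:E)%E.
Proof.
move=> mX; rewrite /Ttail ge_max => /andP[h1 h2].
apply: (@le_trans _ _ (P ([set w | (y < X w)%R] `|` [set w | (X w < - y)%R])%classic)).
  apply: le_measure; rewrite ?inE.
  - by apply: measurable_gt; exact: measurableT_comp.
  - by apply: measurableU; [exact: measurable_gt|exact: measurable_lt].
  - by move=> w /=; rewrite lter_normr => /orP[|]; [left|right; rewrite ltrNr].
apply: le_trans (measureU2 _ _ _) _; [exact: measurable_gt|exact: measurable_lt|].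
by rewrite mulr_natl mulr2n EFinD leeD.
Qed.

End tail_moments.

(** Divided by [a] of order [K k^(1/q)], the variable has a [2k]-th power with tail at most
    [2 / t ^ 2], hence with mean at most [5 <= 5 ^ (2k)]. *)
Lemma tail_even_moment (R : realType) (q : \bar R) : (0 < q)%E ->
  exists2 c : R, 0 < c & forall (K : R) dd (Om : measurableType dd)
    (P : probability Om R) (X : Om -> R), 0 < K -> measurable_fun setT X ->
    (forall y, 0 <= y -> (Ttail P X y <= (tailbd q K y)%:E)%E) ->
    forall k, (0 < k)%N ->
    (\int[P]_w (X w ^+ k.*2)%:E <= ((c * K * k%:R `^ Defs.invq q) ^+ k.*2)%:E)%E.
Proof.
have reduce (a : R) dd (Om : measurableType dd) (P : probability Om R) (X : Om -> R) k :
    0 < a -> measurable_fun setT X -> (0 < k)%N ->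
    (forall t, 1 <= t -> (P [set w | (t < (X w / a) ^+ k.*2)%R] <= (2 / t ^+ 2)%:E)%E) ->
    (\int[P]_w (X w ^+ k.*2)%:E <= ((5 * a) ^+ k.*2)%:E)%E.
  move=> a0 mX k0 tX.
  have mXa : measurable_fun setT (fun w => (X w / a) ^+ k.*2).
    by apply: measurable_funX; exact: measurable_funM.
  have h := integral_le5_of_tail _ _ mXa (fun w => expr_double_ge0 _ _) tX.
  have -> : (\int[P]_w (X w ^+ k.*2)%:E =
      (a ^+ k.*2)%:E * \int[P]_w ((X w / a) ^+ k.*2)%:E)%E.
    rewrite -ge0_integralZl_EFin//.
    - apply: eq_integral => w _.
      by rewrite -EFinM -exprMn mulrC divfK ?gt_eqF.
    - by move=> w _; rewrite lee_fin expr_double_ge0.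
    - exact/measurable_EFinP.
    - exact: expr_double_ge0.
  apply: (@le_trans _ _ ((a ^+ k.*2)%:E * 5%:E)%E).
    by apply: lee_wpmul2l => //; rewrite lee_fin expr_double_ge0.
  rewrite -EFinM lee_fin exprMn mulrC ler_wpM2r ?expr_double_ge0//.
  by rewrite ler_eXnr ?double_gt0// ler1n.
case: q => [r| |]//= q0.
- rewrite lte_fin in q0.
  (* With this factor, [(y / a) ^ (2k) <= t] follows from [v <= exp v] at [v = r ln t / (2k)], for
     the level [y] chosen below. *)
  pose b : R := (4 / r) `^ r^-1.
  have b0 : 0 < b by rewrite powR_gt0// divr_gt0.
  exists (5 * b); first by rewrite mulr_gt0.
  move=> K dd Om P X K0 mX tX k k0.
  have kr : 0 < k%:R :> R by rewrite ltr0n.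
  set a := b * K * k%:R `^ r^-1.
  have a0 : 0 < a by rewrite !mulr_gt0// powR_gt0.
  rewrite (_ : 5 * b * K * k%:R `^ r^-1 = 5 * a); last by rewrite /a !mulrA.
  apply: reduce => // t t1.
  have t0 : 0 < t by exact: lt_le_trans t1.
  (* The level at which the assumed tail bound equals [t ^ -2]. *)
  set y := K * (2 * ln t) `^ r^-1.
  have y0 : 0 <= y by rewrite mulr_ge0 ?powR_ge0 ?ltW.
  have := abs_tail_le P _ _ _ mX (tX _ y0).
  have yK : y / K = (2 * ln t) `^ r^-1 by rewrite mulrC mulKf// gt_eqF.
  rewrite /tailbd yK.
  have lt0 : 0 <= 2 * ln t by rewrite mulr_ge0// ln_ge0.
  have e2 : expR (- (2 * ln t)) = (t ^+ 2)^-1.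
    by rewrite expRN expRM_natl lnK// posrE.
  rewrite -powRrM mulVf ?gt_eqF// powRr1// e2 => h.
  apply: le_trans h; apply: le_measure; rewrite ?inE.
  + by apply: measurable_gt; apply: measurable_funX; exact: measurable_funM.
  + by apply: measurable_gt; exact: measurableT_comp.
  move=> w /= tXw; rewrite ltNge; apply/negP => Xy; move: tXw.
  apply/negP; rewrite -leNgt.
  set z := 2 * ln t in lt0 yK.
  set v := z * r / (4 * k%:R).
  have v0 : 0 <= v.
    by apply: divr_ge0; apply: mulr_ge0 => //; exact: ltW.
  have ya : y / a <= expR (v * r^-1).
    have zE : z `^ r^-1 = v `^ r^-1 * (b * k%:R `^ r^-1).
      have r40 : 0 <= 4 / r by rewrite divr_ge0// ltW.
      have -> : z = v * (4 / r * k%:R) by rewrite /v; field; rewrite !gt_eqF.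
      by rewrite (powRM _ v0 (mulr_ge0 r40 (ltW kr))) (powRM _ r40 (ltW kr)).
    apply: (@le_trans _ _ (v `^ r^-1)).
      rewrite le_eqVlt; apply/orP; left; apply/eqP.
      have -> : y = K * z `^ r^-1 by [].
      rewrite zE /a; field.
      by rewrite !gt_eqF// powR_gt0.
    rewrite expRM ge0_ler_powR ?nnegrE ?invr_ge0 ?expR_ge0 ?(ltW q0)//.
    by rewrite (le_trans _ (expR_ge1Dx v))// lerDr.
  have Xa : `|X w / a| <= expR (v * r^-1).
    by rewrite normrM normfV (gtr0_norm a0) (le_trans _ ya)// ler_pM2r ?invr_gt0.
  rewrite -mul2n exprM -real_normK ?num_real// -exprM mul2n.
  apply: (@le_trans _ _ (expR (v * r^-1) ^+ k.*2)).
    by rewrite lerXn2r ?nnegrE ?expR_ge0.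
  rewrite -expRM_natr -[leRHS]lnK ?posrE// ler_expR.
  rewrite -muln2 natrM (_ : ln t = z / 2); last by rewrite /z; field.
  by rewrite /v le_eqVlt; apply/orP; left; apply/eqP; field; rewrite !gt_eqF.
(* For [q = +oo] the tail bound is still [1] at [K] and vanishes beyond it. The level [2 K] lies
   strictly beyond, so almost surely [|X| <= 2 K]. *)
- exists 10 => // K dd Om P X K0 mX tX k k0.
  rewrite powRr0 mulr1 (_ : 10 * K = 5 * (2 * K)); last by ring.
  have K20 : 0 < 2 * K by rewrite mulr_gt0.
  apply: reduce => // t t1.
  have := abs_tail_le P _ _ _ mX (tX _ (ltW K20)).
  rewrite /= ifF ?mulr0; last by apply/negbTE; rewrite -ltNge; lra.
  move=> h; apply: (@le_trans _ _ 0%:E); last first.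
    by rewrite lee_fin divr_ge0 ?sqr_ge0.
  apply: le_trans h; apply: le_measure; rewrite ?inE.
  + by apply: measurable_gt; apply: measurable_funX; exact: measurable_funM.
  + by apply: measurable_gt; exact: measurableT_comp.
  move=> w /= tXw; rewrite ltNge; apply/negP => XK.
  have : (X w / (2 * K)) ^+ k.*2 <= 1.
    rewrite -mul2n exprM exprn_ile1 ?sqr_ge0// -real_normK ?num_real//.
    by rewrite exprn_ile1// normrM normfV (gtr0_norm K20) ler_pdivrMr// mul1r.
  by rewrite leNgt (le_lt_trans t1 tXw).
Qed.

(** * Splitting off the last index of the polynomial *)

Section last_index.
Variables (d n : nat).

Definition rcons_index (I : {ffun 'I_d -> 'I_n}) (i : 'I_n) : {ffun 'I_d.+1 -> 'I_n} :=
  [ffun m => oapp I i (unlift ord_max m)].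

Lemma rcons_index_max I i : rcons_index I i ord_max = i.
Proof. by rewrite ffunE unlift_none. Qed.

Lemma widen_ord_lift_max (m : 'I_d) : widen_ord (leqnSn d) m = lift ord_max m.
Proof. by apply: val_inj; rewrite /= /bump leqNgt ltn_ord. Qed.

Lemma rcons_index_widen I i m : rcons_index I i (widen_ord (leqnSn d) m) = I m.
Proof. by rewrite ffunE widen_ord_lift_max liftK. Qed.

Lemma sum_rcons_index (V : nmodType) (f : {ffun 'I_d.+1 -> 'I_n} -> V) :
  \sum_I f I = \sum_(i < n) \sum_I f (rcons_index I i).
Proof.
rewrite pair_big/= (reindex (fun p : 'I_n * {ffun 'I_d -> 'I_n} => rcons_index p.2 p.1))//.
exists (fun J : {ffun 'I_d.+1 -> 'I_n} => (J ord_max, [ffun m => J (widen_ord (leqnSn d) m)])).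
  move=> [i I] _ /=; rewrite rcons_index_max; congr (_, _).
  by apply/ffunP => m; rewrite ffunE rcons_index_widen.
move=> J _; apply/ffunP => m; rewrite ffunE/=.
by case: unliftP => [j ->|->//]; rewrite /= ffunE widen_ord_lift_max.
Qed.

Lemma incr_rcons_index I i :
  incr_index (rcons_index I i) = incr_index I && [forall m, (I m < i)%N].
Proof.
apply/forallP/andP => [h|[/forallP hI /forallP hi] m].
  split; apply/forallP => m.
    apply/forallP => m'; have /forallP/(_ (widen_ord (leqnSn d) m')) := h (widen_ord (leqnSn d) m).
    by rewrite !rcons_index_widen.
  have /forallP/(_ ord_max) := h (widen_ord (leqnSn d) m).
  by rewrite rcons_index_widen rcons_index_max/= ltn_ord.
apply/forallP => m'; apply/implyP.
have [j ->|->] := unliftP ord_max m; have [j' ->|->] := unliftP ord_max m';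
  rewrite -?widen_ord_lift_max ?rcons_index_max ?rcons_index_widen//=.
- by move=> jj; have /forallP/(_ j')/implyP := hI j; apply.
- by rewrite ltnNge ltnW.
- by rewrite ltnn.
Qed.

End last_index.

Section Qd_recursion.
Context {R : realType}.
Implicit Types d n : nat.

(** Coefficients of the form of order [d] that multiplies the last difference at index [i].
    Extension by zero encodes the constraint that all other indices are below [i] while keeping the
    same range [n]. *)
Definition slice_coef d n (b : {ffun 'I_d.+1 -> 'I_n} -> R) (i : 'I_n)
    (I : {ffun 'I_d -> 'I_n}) : R :=
  if [forall m, (I m < i)%N] then b (rcons_index _ _ I i) else 0.

(** This exhibits [Q_d] as a martingale transform: the factor of each last difference involves
    earlier times only. *)
Lemma Qd_rcons d n (Om : Type) (b : {ffun 'I_d.+1 -> 'I_n} -> R)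
    (xi : nat -> 'I_d.+1 -> Om -> R) w :
  Qd b xi w = \sum_(i < n) xi i.+1 ord_max w *
    Qd (slice_coef _ _ b i) (fun j m => xi j (widen_ord (leqnSn d) m)) w.
Proof.
rewrite /Qd big_mkcond/= sum_rcons_index; apply: eq_bigr => i _.
rewrite [in RHS]big_mkcond mulr_sumr; apply: eq_bigr => I _.
rewrite incr_rcons_index /slice_coef; case: ifP => [/andP[-> ->]|].
  rewrite big_ord_recr/= rcons_index_max [RHS]mulrC -mulrA; congr (_ * (_ * _)).
  by apply: eq_bigr => m _; rewrite rcons_index_widen.
by case: incr_index => //=; [move=> ->; rewrite mul0r mulr0|rewrite mulr0].
Qed.

(** Index value [j] stands for time [j.+1], so the strict inequality on the support of [b] says that
    only times up to [i] occur. *)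
Lemma Qd_G_measurable d n dd (Om : measurableType dd) (F : nat -> set (set Om))
    (b : {ffun 'I_d -> 'I_n} -> R) (xi : nat -> 'I_d -> Om -> R) i :
  is_filtration F -> (forall m j, (1 <= j)%N -> G_measurable (F j) (xi j m)) ->
  (forall I m, b I != 0 -> (I m < i)%N) -> G_measurable (F i) (Qd b xi).
Proof.
move=> fF Fxi bi; have [sF _ _ _] := fF.
have -> : Qd b xi = fun w => \sum_I
    (if incr_index I then b I * \prod_(m < d) xi (I m).+1 m w else 0).
  by apply/funext => w; rewrite /Qd big_mkcond.
apply: G_measurable_sum => // I; case: (incr_index I); last exact: G_measurable_cst.
have [->|bI] := eqVneq (b I) 0.
  rewrite (_ : (fun _ => _) = fun=> 0 : R); first exact: G_measurable_cst.
  by apply/funext => w; rewrite mul0r.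
apply: G_measurableM => //; first exact: G_measurable_cst.
apply: G_measurable_prod => // m B mB; apply: (filtration_le _ _ F (I m).+1 i fF); first exact: bi.
exact: Fxi.
Qed.

Lemma measurable_Qd d n dd (Om : measurableType dd) (P : probability Om R)
    (F : nat -> set (set Om)) (b : {ffun 'I_d -> 'I_n} -> R) (xi : nat -> 'I_d -> Om -> R) :
  is_filtration F -> (forall m, is_mart_diff P F (fun i => xi i m)) ->
  measurable_fun setT (Qd b xi).
Proof.
move=> fF md; have [_ Fm _ _] := fF.
apply: (G_measurable_measurable _ _ (Fm n)); apply: Qd_G_measurable => // m j j1.
by case: (md m j j1).
Qed.

End Qd_recursion.

(** * Moment bound for [Q_d] by induction on the order *)

Lemma prodK_recr (R : realType) d (K : 'I_d.+1 -> R) :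
  prodK K = prodK (fun m => K (widen_ord (leqnSn d) m)) * K ord_max.
Proof. by rewrite /prodK big_ord_recr. Qed.

(* The majorant [s] of [b ^ 2] is there to be positive: the coefficients themselves may vanish. *)
Lemma Qd_even_moment (R : realType) (d : nat) (q : 'I_d -> \bar R) :
  (forall m, (0 < q m)%E) ->
  exists2 C : R, 0 < C & forall (K : 'I_d -> R) dd (Om : measurableType dd)
    (P : probability Om R) (F : nat -> set (set Om)) (xi : nat -> 'I_d -> Om -> R)
    n (b s : {ffun 'I_d -> 'I_n.+1} -> R) k,
    (forall m, 0 < K m) -> is_filtration F ->
    (forall m, is_mart_diff P F (fun i => xi i m)) ->
    (forall m i y, (1 <= i)%N -> 0 <= y ->
       (Ttail P (xi i m) y <= (tailbd (q m) (K m) y)%:E)%E) ->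
    (forall I, b I ^+ 2 <= s I) -> (forall I, 0 < s I) ->
    (\int[P]_w (Qd b xi w ^+ k.+1.*2)%:E <=
      ((C * prodK K ^+ 2 * k.+1%:R `^ (d%:R + 2 * \sum_(m < d) Defs.invq (q m)) *
        \sum_I s I) ^+ k.+1)%:E)%E.
Proof.
elim: d q => [|d ih] q q0.
  exists 1 => // K dd Om P F xi n b s k _ _ _ _ bs _.
  pose I0 : {ffun 'I_0 -> 'I_n.+1} := [ffun=> ord0].
  have I0E I : I = I0 by apply/ffunP => -[].
  have incr0 : incr_index I0 by apply/forallP => -[].
  rewrite /prodK !big_ord0 mulr0 addr0 powRr0 expr1n !mul1r.
  rewrite (big_pred1 I0); last by move=> I; rewrite /= (I0E I) eqxx.
  under eq_integral => w _.
    rewrite /Qd (big_pred1 I0); last first.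
      by move=> I; rewrite /= (I0E I) incr0 eqxx.
    rewrite big_ord0 mulr1; over.
  rewrite /= integral_cst// [X in (_ * X)%E]probability_setT mule1 lee_fin -mul2n exprM.
  by rewrite lerXn2r ?nnegrE ?sqr_ge0// (le_trans _ (bs I0)) ?sqr_ge0.
pose wd := widen_ord (leqnSn d).
have [C0 C00 hC0] := ih (q \o wd) (fun m => q0 (wd m)).
have [c c0 hc] := tail_even_moment R (q ord_max) (q0 ord_max).
set e0 := d%:R + 2 * \sum_(m < d) Defs.invq ((q \o wd) m) in hC0.
set e1 := Defs.invq (q ord_max) in hc.
(* The [6] is [5] from the martingale inequality plus [1] for the slack, which is taken equal to
   [al * D0 * T]. The power of [2] comes from the doubling of the moment order by Cauchy-Schwarz. *)
exists (6 * c ^+ 2 * C0 * 2 `^ (2 * e1 + e0)).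
  by rewrite mulr_gt0 ?powR_gt0// mulr_gt0// mulr_gt0// exprn_gt0.
move=> K dd Om P F xi n b s k K0 fF md tl bs s0.
have [sF Fm Fi _] := fF.
set K' := prodK (K \o wd); set Kd := K ord_max.
have K'0 : 0 < K' by apply: prodr_gt0 => m _; exact: K0.
have Kd0 : 0 < Kd by exact: K0.
pose sI (i : 'I_n.+1) := \sum_(I : {ffun 'I_d -> 'I_n.+1}) s (rcons_index _ _ I i).
have sI0 i : 0 < sI i.
  rewrite /sI (bigD1 [ffun=> i])//= ltr_pwDl// sumr_ge0// => I _.
  exact: ltW.
have TE : \sum_I s I = \sum_i sI i by rewrite sum_rcons_index.
set T := \sum_I s I in TE *.
have T0 : 0 < T.
  by rewrite TE big_ord_recl/= ltr_pwDl// sumr_ge0// => i _; exact: ltW.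
set k2 : R := k.+1.*2%:R.
have k20 : 0 < k2 by rewrite ltr0n double_gt0.
(* [al] bounds the squared [L^(2 k2)] norm of a last difference, and [D0 * sI i] that of the form
   multiplying it. *)
set al := (c * Kd * k2 `^ e1) ^+ 2.
have al0 : 0 < al by rewrite exprn_gt0// !mulr_gt0// powR_gt0.
set D0 := C0 * K' ^+ 2 * k2 `^ e0.
have D00 : 0 < D0 by rewrite mulr_gt0 ?powR_gt0// mulr_gt0// exprn_gt0.
pose X i w := xi i.+1 ord_max w *
  Qd (slice_coef _ _ b (inord i)) (fun j m => xi j (wd m)) w.
have QE w : Qd b xi w = \sum_(i < n.+1) X i w.
  by rewrite Qd_rcons; apply: eq_bigr => i _; rewrite /X inord_val.
under eq_integral do rewrite QE.
have Fxi m j : (1 <= j)%N -> G_measurable (F j) (xi j m) by move=> j1; case: (md m j j1).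
have FQ i : (i < n.+1)%N ->
    G_measurable (F i) (Qd (slice_coef _ _ b (inord i)) (fun j m => xi j (wd m))).
  move=> ni; apply: Qd_G_measurable => // [m j|I m]; first exact: Fxi.
  rewrite /slice_coef; case: ifP => [/forallP/(_ m)|]; last by rewrite eqxx.
  by rewrite inordK.
have mxi i : measurable_fun setT (xi i.+1 ord_max).
  exact: G_measurable_measurable (Fm i.+1) (Fxi _ i.+1 _).
have sumsE : \sum_(i < n.+1) (al * (D0 * sI (inord i))) = al * D0 * T.
  rewrite TE mulr_sumr; apply: eq_bigr => i _.
  by rewrite inord_val mulrA.
apply: le_trans (even_moment_martingale P F X (fun i => al * (D0 * sI (inord i)))
  (al * D0 * T) k n.+1 fF _ _ _ _ _) _.
- exact: mulr_gt0 (mulr_gt0 al0 D00) T0.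
- by move=> i ni; exact: mulr_gt0 al0 (mulr_gt0 D00 (sI0 _)).
- move=> i ni; apply: G_measurableM => //; first exact: Fxi.
  by move=> B mB; apply: Fi; exact: FQ.
(* The form multiplying the last difference is known at time [i], so it is absorbed into the test
   function [Y]. *)
- move=> i ni Y FY.
  have /= [_ ixi xi0] := md ord_max i.+1 isT.
  have YE w : Y w * X i w =
      (Y w * Qd (slice_coef _ _ b (inord i)) (fun j m => xi j (wd m)) w) * xi i.+1 ord_max w.
    by rewrite /X mulrCA mulrC.
  rewrite (_ : (fun w => (Y w * X i w)%:E) = fun w => ((Y w *
    Qd (slice_coef _ _ b (inord i)) (fun j m => xi j (wd m)) w) * xi i.+1 ord_max w)%:E).
    move=> iY; apply: (centered_givenP P (F i)) => //.
    by apply: G_measurableM => //; exact: FQ.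
  by apply/funext => w; rewrite YE.
- move=> i ni; apply: even_moment_mul => //.
  + exact: G_measurable_measurable (Fm i) (FQ i ni).
  + exact: mulr_gt0 D00 (sI0 _).
  + rewrite /al -exprM mul2n; apply: hc => // y y0.
    exact: tl.
  + apply: (hC0 _ _ _ P F _ _ _ (fun I => s (rcons_index _ _ I (inord i))) k.*2.+1) => //.
    * by move=> m; exact: K0.
    * by move=> m j y j1 y0; exact: tl.
    * move=> I; rewrite /slice_coef; case: ifP => // _.
      by rewrite expr0n/= ltW.
rewrite sumsE lee_fin.
have D0T : 0 <= al * D0 * T := ltW (mulr_gt0 (mulr_gt0 al0 D00) T0).
set p : R := k.+1%:R.
have p1 : 1 <= p by rewrite ler1n.
have p0 : 0 < p by exact: lt_le_trans p1.
have -> : 6 * c ^+ 2 * C0 * 2 `^ (2 * e1 + e0) * prodK K ^+ 2 *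
    p `^ (d.+1%:R + 2 * \sum_(m < d.+1) Defs.invq (q m)) = 6 * p * (al * D0).
  rewrite prodK_recr -/Kd -/wd big_ord_recr/= -/e1.
  have -> : d.+1%:R + 2 * (\sum_(m < d) Defs.invq (q (wd m)) + e1) = 1 + (e1 + e1) + e0.
    by rewrite /e0 -natr1/=; ring.
  have -> : 2 * e1 + e0 = e1 + e1 + e0 by ring.
  have pD (x u v : R) : 0 < x -> x `^ (u + v) = x `^ u * x `^ v.
    by move=> x0; rewrite powRD// (gt_eqF x0) implybT.
  rewrite (pD p (1 + (e1 + e1)) e0 p0) (pD p 1 _ p0) (pD p e1 e1 p0).
  rewrite (pD 2 (e1 + e1) e0)// (pD 2 e1 e1)// powRr1 ?(ltW p0)// /al /D0.
  have -> : k2 = 2 * p by rewrite /k2 /p -muln2 natrM mulrC.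
  rewrite !(powRM _ (ler0n _ 2) (ltW p0)).
  rewrite /K' /Kd (_ : prodK (fun m => K (wd m)) = prodK (K \o wd))//.
  by ring.
apply: lerXn2r; rewrite ?nnegrE.
- by apply: addr_ge0 => //; apply: mulr_ge0 => //; apply: mulr_ge0 => //; exact: ltW.
- rewrite -mulrA; apply: mulr_ge0 => //; apply: mulr_ge0 => //; exact: ltW.
have : 0 <= (p - 1) * (al * D0 * T) by apply: mulr_ge0 => //; rewrite subr_ge0.
by rewrite -/p; lra.
Qed.

(** * From moments back to tails, and the upper bound *)

Lemma even_markov (R : realType) dd (Om : measurableType dd) (P : probability Om R)
    (X : Om -> R) (A : set Om) (x : R) k : measurable A -> measurable_fun setT X ->
  0 <= x -> (forall w, A w -> x <= `|X w|) ->
  ((x ^+ k.*2)%:E * P A <= \int[P]_w (X w ^+ k.*2)%:E)%E.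
Proof.
move=> mA mX x0 xX.
rewrite -[A in P A]setIT -integral_indic// -ge0_integralZl_EFin//.
- apply: ge0_le_integral => //.
  + by move=> w _; rewrite -EFinM lee_fin mulr_ge0// exprn_ge0.
  + apply/measurable_EFinP/measurable_funM => //; exact: measurable_indic.
  + by apply/measurable_EFinP; exact: measurable_funX.
  + move=> w _; rewrite -EFinM lee_fin indicE; have [/set_mem Aw|] := boolP (w \in A).
      rewrite mulr1 -mul2n !exprM -(real_normK (num_real (X w))).
      by rewrite !lerXn2r ?nnegrE ?exprn_ge0 ?xX.
    by rewrite mulr0 expr_double_ge0.
- exact/measurable_EFinP/measurable_indic.
- exact: exprn_ge0.
Qed.

(** The reciprocal of [Mexp]: the power of [k] that bounds the growth of the [L^(2k)] norms. *)
Definition growth_exponent (R : realType) d (q : 'I_d -> \bar R) : R :=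
  d%:R / 2 + \sum_(m < d) Defs.invq (q m).

Lemma growth_exponent_gt0 (R : realType) d (q : 'I_d -> \bar R) :
  (1 <= d)%N -> (forall m, (0 < q m)%E) -> 0 < growth_exponent R d q.
Proof.
move=> d1 q0; rewrite ltr_pwDl ?divr_gt0 ?ltr0n//; apply: sumr_ge0 => m _.
by move: (q0 m); case: (q m) => [r| |]//=; rewrite lte_fin => /ltW; rewrite invr_ge0.
Qed.

Lemma prodK_gt0 (R : realType) d (K : 'I_d -> R) : (forall m, 0 < K m) -> 0 < prodK K.
Proof. by move=> K0; apply: prodr_gt0 => m _; exact: K0. Qed.

(** Markov's inequality at order [2 k.+1], where [k.+1] is the integer part of [y]. The moment bound
    is then at most [(x ^ 2 / e ^ 2) ^ k.+1], so the probability is at most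
    [exp(- 2 k.+1) <= exp(- y)]. *)
Lemma tail_of_even_moments (R : realType) (C e : R) : 0 < C -> 0 < e ->
  exists2 c : R, 1 <= c & forall dd (Om : measurableType dd) (P : probability Om R)
    (X : Om -> R) (kappa x : R), measurable_fun setT X -> 0 < kappa -> c * kappa < x ->
    (forall k, (\int[P]_w (X w ^+ k.+1.*2)%:E <=
      ((C * kappa ^+ 2 * k.+1%:R `^ (2 * e)) ^+ k.+1)%:E)%E) ->
    (Ttail P X x <= (expR (- ((x / (c * kappa)) `^ e^-1)))%:E)%E.
Proof.
(* The factor [expR 1] yields the gain [exp(-2)]; the factor [1 + C] absorbs [C], because
   [C <= (1 + C) ^ 2]. *)
move=> C0 e0; set c := expR 1 * (1 + C).
have e1 : 1 <= expR 1 :> R by rewrite -[leLHS]expR0 ler_expR.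
have c1 : 1 <= c by rewrite /c; nra.
exists c => // dd Om P X kappa x mX ka0 cx hX.
have c0 : 0 < c by exact: lt_le_trans c1.
have cka0 : 0 < c * kappa by exact: mulr_gt0.
have x0 : 0 < x by exact: lt_trans cx.
set y := (x / (c * kappa)) `^ e^-1.
have y1 : 1 <= y.
  rewrite -[leLHS](_ : 1 `^ e^-1 = 1); last by rewrite powR1.
  rewrite ge0_ler_powR ?nnegrE ?invr_ge0 ?(ltW e0)//.
    by rewrite divr_ge0// ltW.
  by rewrite ler_pdivlMr// mul1r ltW.
have y0 : 0 <= y by exact: le_trans y1.
have [k /andP[ky yk]] : exists k, k.+1%:R <= y < k.+2%:R.
  have /andP[h1 h2] := truncn_itv y0.
  case: (Num.truncn y) h1 h2 => [|k] h1 h2; first by move: h2; rewrite ltNge y1.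
  by exists k; rewrite h1 h2.
have xE : x / (c * kappa) = y `^ e.
  by rewrite /y -powRrM mulVf ?gt_eqF// powRr1// divr_ge0// ltW.
have ke : k.+1%:R `^ (2 * e) <= (x / (c * kappa)) ^+ 2.
  rewrite mulrC powRrM (powR_mulrn 2 (powR_ge0 _ _)) xE.
  apply: lerXn2r; rewrite ?nnegrE ?powR_ge0//.
  by apply: ge0_ler_powR; rewrite ?nnegrE// ltW.
have main A : measurable A -> (forall w, A w -> x <= `|X w|) -> (P A <= (expR (- y))%:E)%E.
  move=> mA xA.
  have := le_trans (even_markov _ _ _ P X A x k.+1 mA mX (ltW x0) xA) (hX k).
  have xk0 : 0 < x ^+ k.+1.*2 by rewrite exprn_gt0.
  rewrite -lee_pdivlMl// => h; apply: le_trans h _.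
  rewrite -EFinM lee_fin ler_pdivrMl//.
  apply: (@le_trans _ _ ((expR (- 2) * x ^+ 2) ^+ k.+1)).
    have Ck : 0 <= C * kappa ^+ 2 by apply: mulr_ge0; [exact: ltW|exact: sqr_ge0].
    apply: lerXn2r; rewrite ?nnegrE.
    - by apply: mulr_ge0 => //; exact: powR_ge0.
    - by apply: mulr_ge0; [exact: expR_ge0|exact: sqr_ge0].
    apply: le_trans (ler_wpM2l Ck ke) _.
    have -> : C * kappa ^+ 2 * (x / (c * kappa)) ^+ 2 = C / (1 + C) ^+ 2 * (expR (-2) * x ^+ 2).
      have -> : expR (- 2) = (expR 1 ^+ 2)^-1 :> R by rewrite expRN -expRM_natl mulr1.
      rewrite /c.
      by field; rewrite !gt_eqF ?expR_gt0//; lra.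
    rewrite -[leRHS]mul1r; apply: ler_wpM2r.
      by apply: mulr_ge0; [exact: expR_ge0|exact: sqr_ge0].
    by rewrite ler_pdivrMr ?exprn_gt0//; nra.
  rewrite exprMn -exprM mul2n mulrC ler_wpM2l ?(ltW xk0)//.
  rewrite -expRM_natl ler_expR mulrN lerN2.
  have : k.+2%:R <= k.+1%:R * 2 :> R.
    by rewrite -(natrM _ k.+1 2) ler_nat muln2 doubleS !ltnS -addnn leq_addr.
  by apply: le_trans; exact: ltW.
rewrite /Ttail ge_max; apply/andP; split; apply: main.
- exact: measurable_gt.
- by move=> w /= h; rewrite ler_normr ltW.
- exact: measurable_lt.
- by move=> w /= h; rewrite ler_normr orbC lerNr ltW.
Qed.

Lemma Ssup_upper (R : realType) (d : nat) (q : 'I_d -> \bar R) :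
  (1 <= d)%N -> (forall m, (0 < q m)%E) ->
  exists2 c : R, 1 <= c & forall K : 'I_d -> R, (forall m, 0 < K m) ->
    forall x, c * prodK K < x ->
    (Ssup q K x <= (expR (- ((x / (c * prodK K)) `^ (Mexp q))))%:E)%E.
Proof.
move=> d1 q0; have e0 := growth_exponent_gt0 R d q d1 q0.
have [C C0 hC] := Qd_even_moment R d q q0.
have [c c1 hc] := tail_of_even_moments R (C * 2) _ (mulr_gt0 C0 (ltr0Sn _ 1)) e0.
exists c => // K K0 x cx; apply: ge_ereal_sup => _
  [dd [Om [P [F [xi [n [b [[fF md] tl n1 bB ->]]]]]]]].
case: n b n1 bB => [//|n] b _ bB.
(* The moment bound sums its majorant over all index maps, so [b] is first set to zero off the
   increasing ones. *)
pose b' (I : {ffun 'I_d -> 'I_n.+1}) := if incr_index I then b I else 0.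
have -> : Qd b xi = Qd b' xi.
  by apply/funext => w; apply: eq_bigr => I hI; rewrite /b' hI.
have mQ : measurable_fun setT (Qd b' xi) by exact: (measurable_Qd _ _ _ _ P F b' xi fF md).
apply: hc => //; first exact: prodK_gt0.
move=> k.
(* Adding [N^-1] to each square makes the majorant positive and brings its total to [2], whence the
   constant [C * 2]. *)
pose N : R := #|{ffun 'I_d -> 'I_n.+1}|%:R.
have N0 : 0 < N by rewrite ltr0n; apply/card_gt0P; exists [ffun=> ord0].
have := hC K dd Om P F xi n b' (fun I => b' I ^+ 2 + N^-1) k K0 fF md tl.
have -> : \sum_I (b' I ^+ 2 + N^-1) = 2.
  rewrite big_split/= sumr_const -[_ *+ _]mulr_natl mulfV ?gt_eqF//.
  rewrite (_ : \sum_I b' I ^+ 2 = 1)//.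
  rewrite -[RHS]bB [RHS]big_mkcond/=; apply: eq_bigr => I _.
  by rewrite /b'; case: ifP; rewrite ?expr0n.
rewrite (_ : d%:R + _ = 2 * growth_exponent R d q); last by rewrite /growth_exponent; field.
rewrite (_ : C * _ * _ * 2 = C * 2 * prodK K ^+ 2 * k.+1%:R `^ (2 * growth_exponent R d q));
  last by ring.
apply => I; first by rewrite lerDl invr_ge0 ltW.
by rewrite ltr_wpDl ?sqr_ge0// invr_gt0.
Qed.

(** * The extremal martingale: a run of fair signs on nested events *)

Section extremal_martingale.
Context {R : realType} {dd : measure_display} {Om : measurableType dd}.
Variable P : probability Om R.
Variables (E : nat -> set Om) (p : R).
Hypothesis mE : forall i, measurable (E i).
Hypothesis subE : forall i, E i.+1 `<=` E i.
Hypothesis PE : forall i, (P (E i) = (p / 2 ^+ i)%:E)%E.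

Lemma nested_le i j : (i <= j)%N -> E j `<=` E i.
Proof.
elim: j => [|j ih]; first by rewrite leqn0 => /eqP ->.
rewrite leq_eqVlt => /orP[/eqP -> A //|]; rewrite ltnS => /ih.
by move=> ij A /subE; exact: ij.
Qed.

(* Everything outside [E i] is known at time [i], nothing inside; at time [0] the atom is
   the whole space, since the mass of [E 0] is exponentially small but [F 0] must be trivial. *)
Definition atom_filtration i : set (set Om) := [set A | measurable A /\
  let D := if i is 0%N then setT else E i in D `<=` A \/ A `&` D = set0].

Lemma atom_filtrationP : is_filtration atom_filtration.
Proof.
split.
- move=> i; split.
  + by split=> //; right; rewrite set0I.
  + move=> A [mA DA]; rewrite setTD; split; first exact: measurableC.
    case: DA => DA; [right|left].
      by rewrite setIC; apply/disjoints_subset; rewrite setCK.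
    by apply/disjoints_subset; rewrite setIC.
  + move=> A FA; split; first by apply: bigcupT_measurable => k; case: (FA k).
    have [[k kA]|noA] := pselect (exists k, (if i is 0%N then setT else E i) `<=` A k).
      by left; apply: subset_trans kA _; exact: bigcup_sup.
    right; rewrite setI_bigcupl; apply: bigcup0 => k _.
    by have [_ []] // := FA k => h; exfalso; apply: noA; exists k.
- by move=> i A [].
- move=> i A [mA DA]; split => //=.
  have sub : E i.+1 `<=` (if i is 0%N then setT else E i) by case: i {DA} => // i; exact: subE.
  case: DA => DA; [left; exact: subset_trans DA|right].
  by apply/seteqP; split => // w [Aw Ew]; rewrite -[set0]DA; split => //; exact: sub.
- move=> A; split => [[_ [TA|]]|[->|->]]; rewrite ?setIT.
  + by right; apply/seteqP; split.
  + by left.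
  + by split => //; right; rewrite set0I.
  + by split => //; left.
Qed.

(** For [i >= 1] this is [1] on [E i], [-1] on the rest of [E i.-1] and [0] elsewhere: a fair sign,
    switched on by [E 0] and stopped after the first negative value. *)
Definition atom_step i w : R := 2 * \1_(E i) w - \1_(E i.-1) w.

Lemma atom_step1 i w : E i w -> atom_step i w = 1.
Proof.
move=> Ew; have Ew' : E i.-1 w by apply: nested_le Ew; exact: leq_pred.
by rewrite /atom_step !indicE !mem_set//=; lra.
Qed.

Lemma atom_step0 i w : ~ E i.-1 w -> atom_step i w = 0.
Proof.
move=> Ew; have Ew' : ~ E i w by move=> /(nested_le _ _ (leq_pred i)).
by rewrite /atom_step !indicE !memNset//=; lra.
Qed.

Lemma norm_atom_step_le1 i w : `|atom_step i w| <= 1.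
Proof.
have [Ew|nEw] := pselect (E i w); first by rewrite atom_step1// normr1.
rewrite /atom_step !indicE (memNset nEw)/= mulr0 sub0r normrN.
by case: (_ \in _); rewrite /= ?normr0 ?normr1.
Qed.

Lemma measurable_atom_step i : measurable_fun setT (atom_step i).
Proof.
apply: measurable_funB; last exact: measurable_indic.
by apply: measurable_funM => //; exact: measurable_indic.
Qed.

(** The step lives on [E i.-1], which a set known at time [i.-1] either contains or misses. If it is
    contained, the integral vanishes because the mass halves from [E i.-1] to [E i]. *)
Lemma atom_step_mart_diff (a : R) :
  is_mart_diff P atom_filtration (fun i w => a * atom_step i w).
Proof.
case=> // i _.
have mi : measurable_fun setT (fun w => a * atom_step i.+1 w).
  by apply: measurable_funM => //; exact: measurable_atom_step.
have i1 := integrable_indic P (mE i.+1); have i0 := integrable_indic P (mE i).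
split.
(* On the atom [E i.+1] the function is constant, equal to [a]; hence a preimage contains or misses
   this atom according to whether [B] contains [a]. *)
- move=> B mB; split; first by have := mi measurableT _ mB; rewrite setTI.
  have [Ba|Ba] := pselect (B a); [left|right] => /=.
    by move=> w Ew; rewrite /= atom_step1// mulr1.
  apply/seteqP; split => // w [/= + Ew].
  by rewrite atom_step1// mulr1.
- have -> : EFin \o (fun w => a * atom_step i.+1 w) = (fun w => a%:E *
      (2%:E * (\1_(E i.+1) w)%:E - (\1_(E i) w)%:E))%E.
    by apply/funext => w; rewrite /= EFinM EFinB EFinM.
  apply: integrableZl => //; apply: integrableB => //; exact: integrableZl.
- move=> A [mA DA].
  have -> : (\int[P]_(w in A) (a * atom_step i.+1 w)%:E = \int[P]_(w in A) (a%:E *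
      (2%:E * (\1_(E i.+1) w)%:E - (\1_(E i) w)%:E)))%E.
    by apply: eq_integral => w _; rewrite /= EFinM EFinB EFinM.
  have iA1 := integrableS measurableT mA (@subsetT _ A) i1.
  have iA0 := integrableS measurableT mA (@subsetT _ A) i0.
  have iA2 := integrableZl mA 2 iA1.
  rewrite integralZl//; last exact: integrableB.
  rewrite integralB// integralZl// !integral_indic//.
  have [EA|EA] : E i `<=` A \/ A `&` E i = set0.
    case: i {mi i1 i0 iA1 iA0 iA2} DA => //= -[h|]; first by left; exact: subset_trans h.
    by rewrite setIT => ->; right; rewrite set0I.
  + rewrite !setIidl//; last exact: subset_trans (subE i) EA.
    rewrite [X in (_ * X - _)%E]PE [X in (_ - X)%E]PE.
    transitivity (a * (2 * (p / 2 ^+ i.+1) - p / 2 ^+ i))%:E; first by [].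
    congr EFin; rewrite exprS.
    have z0 : 0 < 2 ^+ i :> R by rewrite exprn_gt0.
    by move: (2 ^+ i) z0 => z z0; field; rewrite gt_eqF.
  + rewrite [E i `&` A]setIC EA (_ : E i.+1 `&` A = set0) ?measure0 ?mule0 ?sube0 ?mule0//.
    by apply/seteqP; split => // w [/subE Ew Aw]; rewrite -EA.
Qed.

(** Below the amplitude [K l^(1/q)] the tail is at most the mass [exp(-l)] of [E 0]; for finite [q]
    this is exactly the allowed bound at the amplitude. From the amplitude on, the tail is zero. *)
Lemma atom_step_tail (q : \bar R) (K l y : R) i : (0 < q)%E -> 0 < K -> 0 <= l ->
  p = expR (- l) -> 0 <= y ->
  (Ttail P (fun w => (K * l `^ Defs.invq q * atom_step i w)%R) y <= (tailbd q K y)%:E)%E.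
Proof.
move=> q0 K0 l0 pE y0.
set a := K * l `^ Defs.invq q.
have a0 : 0 <= a by rewrite mulr_ge0 ?powR_ge0 ?ltW.
have mX : measurable_fun setT (fun w => a * atom_step i w).
  by apply: measurable_funM => //; exact: measurable_atom_step.
suff main A : measurable A -> (forall w, A w -> y < `|a * atom_step i w|) ->
    (P A <= (tailbd q K y)%:E)%E.
  rewrite /Ttail ge_max; apply/andP; split; apply: main.
  - exact: measurable_gt.
  - by move=> w /= h; rewrite lter_normr h.
  - exact: measurable_lt.
  - by move=> w /= h; rewrite lter_normr orbC ltrNr h.
move=> mA yA.
have tail0 : 0 <= tailbd q K y.
  by rewrite /tailbd; case: q {q0 a a0 mX yA} => [r| |]; [exact: expR_ge0|case: ifP|case: ifP].
have [->|/set0P[w0 Aw0]] := eqVneq A set0; first by rewrite measure0 lee_fin.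
have AE : A `<=` E 0%N.
  move=> w /yA yw; apply: (nested_le 0%N i.-1) => //; apply: contrapT => /atom_step0 s0.
  by move: yw; rewrite s0 mulr0 normr0 ltNge y0.
have ya : y < a.
  apply: lt_le_trans (yA _ Aw0) _; rewrite normrM ger0_norm//.
  by rewrite ler_piMr// norm_atom_step_le1.
apply: (@le_trans _ _ (P (E 0%N))); first by apply: le_measure; rewrite ?inE.
rewrite PE expr0 divr1 lee_fin pE.
move: ya; rewrite /a => {a a0 mX yA tail0}.
case: q q0 => [r| |]//= q0 ya.
- rewrite lte_fin in q0.
  rewrite ler_expR lerN2.
  have -> : l = (l `^ r^-1) `^ r by rewrite -powRrM mulVf ?gt_eqF// powRr1.
  rewrite ge0_ler_powR ?nnegrE ?powR_ge0 ?(ltW q0)//; first by rewrite divr_ge0// ltW.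
  by rewrite ler_pdivrMr// mulrC ltW.
- rewrite powRr0 mulr1 in ya.
  by rewrite (ltW ya) -[leRHS]expR0 ler_expR oppr_le0.
Qed.

End extremal_martingale.

(** * The lower bound *)

Lemma uniform_prob01_itv (R : realType) (c : R) : 0 < c -> c <= 1 ->
  uniform_prob (@ltr01 R) `[0, c]%classic = c%:E.
Proof.
move=> c0 c1; rewrite /uniform_prob integral_uniform_pdf.
have -> : (`[0, c] `&` `[0, 1])%classic = `[0, c]%classic :> set R.
  by apply/setIidl => u /=; rewrite !in_itv/= => /andP[-> /le_trans ->].
rewrite (eq_integral (fun=> 1%:E)); last first.
  move=> u; rewrite inE/= in_itv/= => /andP[u0 uc].
  by rewrite /uniform_pdf u0 (le_trans uc c1)/= subr0 invr1.
by rewrite integral_cst//= lebesgue_measure_itv/= lte_fin c0 sube0 mul1e.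
Qed.

(** If the [m]-th index is confined to the [m]-th of [d] consecutive blocks of length [l], every
    choice is increasing. *)
Lemma card_incr_index_ge (d l : nat) : (0 < d * l)%N ->
  (l ^ d <= #|[pred I : {ffun 'I_d -> 'I_(d * l)} | incr_index I]|)%N.
Proof.
move=> dl.
have lt (m : 'I_d) (j : 'I_l) : (m * l + j < d * l)%N.
  apply: (@leq_trans (m.+1 * l)); first by rewrite mulSn addnC ltn_add2r.
  by rewrite leq_mul2r ltn_ord orbT.
pose f (g : {ffun 'I_d -> 'I_l}) : {ffun 'I_d -> 'I_(d * l)} :=
  [ffun m => Ordinal (lt m (g m))].
have fI : injective f.
  move=> g h /ffunP gh; apply/ffunP => m; apply: val_inj.
  by have /(congr1 val) := gh m; rewrite !ffunE/= => /addnI.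
rewrite -[l in (l ^ d)%N]card_ord -[d in (_ ^ d)%N]card_ord -card_ffun.
rewrite -(card_codom fI); apply: subset_leq_card; apply/fintype.subsetP => _ /codomP[g ->].
apply/forallP => i; apply/forallP => j; apply/implyP => ij; rewrite !ffunE/=.
apply: (@leq_trans (i.+1 * l)); first by rewrite mulSn addnC ltn_add2r.
by rewrite (leq_trans _ (leq_addr _ _))// leq_mul2r ij orbT.
Qed.

Lemma prod_powR (R : realType) (I : finType) (a : R) (f : I -> R) : 0 < a ->
  \prod_i a `^ f i = a `^ (\sum_i f i).
Proof.
move=> a0; elim/big_rec2: _ => [|i u v _ ->]; first by rewrite powRr0.
by rewrite powRD// (gt_eqF a0) implybT.
Qed.

Lemma Ssup_lower (R : realType) (d : nat) (q : 'I_d -> \bar R) (K : 'I_d -> R) (x : R) :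
  (1 <= d)%N -> (forall m, (0 < q m)%E) -> (forall m, 0 < K m) -> prodK K <= x ->
  ((expR (- (4 * d%:R * (x / prodK K) `^ (Mexp q))))%:E <= Ssup q K x)%E.
Proof.
move=> d1 q0 K0 Kx; have e0 := growth_exponent_gt0 R d q d1 q0.
set e := growth_exponent R d q in e0.
have ka0 := prodK_gt0 R d K K0.
set kappa := prodK K in ka0 Kx *.
have xk0 : 0 <= x / kappa by rewrite divr_ge0 ?(ltW ka0)// (le_trans (ltW ka0)).
set y := (x / kappa) `^ (Mexp q).
have y1 : 1 <= y.
  rewrite -[leLHS](_ : 1 `^ Mexp q = 1); last by rewrite powR1.
  rewrite ge0_ler_powR ?nnegrE//; last by rewrite ler_pdivlMr// mul1r.
  by rewrite invr_ge0 ltW.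
have y0 : 0 <= y by exact: le_trans y1.
(* Strictness in [y < l] gives [Q_d > x] strictly; the bound [l <= 2 y], available since [y >= 1],
   controls the probability. *)
have [l l0 /andP[yl ly]] : exists2 l : nat, (0 < l)%N & y < l%:R <= 2 * y.
  exists (Num.truncn y).+1 => //; have /andP[h1 h2] := truncn_itv y0.
  by rewrite h2/= -natr1; lra.
pose n := (d * l)%N; have n0 : (0 < n)%N by rewrite muln_gt0 d1.
pose L : R := n%:R; have L0 : 0 <= L by [].
pose p := expR (- L).
have p0 : 0 < p by exact: expR_gt0.
have p1 : p <= 1 by rewrite -[leRHS]expR0 ler_expR oppr_le0.
pose P := uniform_prob (@ltr01 R).
(* Nested intervals at the origin under the uniform law on the unit interval realise the masses
   [p / 2 ^ i]. *)
pose E i := `[0, p / 2 ^+ i]%classic : set (measurableTypeR R).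
have pi0 i : 0 < p / 2 ^+ i by rewrite divr_gt0// exprn_gt0.
have mE i : measurable (E i) by exact: measurable_itv.
have subE i : E i.+1 `<=` E i.
  move=> u; rewrite /E/= !in_itv/= => /andP[-> /le_trans]; apply.
  by rewrite ler_wpM2l ?(ltW p0)// lef_pV2 ?posrE ?exprn_gt0// ler_weXn2l// ler1n.
have PE i : P (E i) = (p / 2 ^+ i)%:E.
  apply: uniform_prob01_itv => //.
  by rewrite ler_pdivrMr ?exprn_gt0// mul1r (le_trans p1)// exprn_ege1// ler1n.
pose xi i m w := K m * L `^ Defs.invq (q m) * atom_step E i w.
pose N : R := #|[pred I : {ffun 'I_d -> 'I_n} | incr_index I]|%:R.
have lN : l%:R ^+ d <= N by rewrite -natrX ler_nat card_incr_index_ge.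
have lr0 : 0 < l%:R :> R by rewrite ltr0n.
have N0 : 0 < N by apply: lt_le_trans lN; rewrite exprn_gt0.
pose b (I : {ffun 'I_d -> 'I_n}) := (Num.sqrt N)^-1.
have QE w : E n w -> x < Qd b xi w.
  move=> Ew.
  have xi1 m j : (j < n)%N -> xi j.+1 m w = K m * L `^ Defs.invq (q m).
    move=> jn; rewrite /xi (atom_step1 E subE) ?mulr1//.
    exact: (nested_le E subE) Ew.
  have -> : Qd b xi w = Num.sqrt N * (kappa * L `^ (\sum_(m < d) Defs.invq (q m))).
    rewrite /Qd (eq_bigr (fun=> (Num.sqrt N)^-1 *
        \prod_(m < d) (K m * L `^ Defs.invq (q m)))); last first.
      by move=> I _; congr (_ * _); apply: eq_bigr => m _; rewrite xi1.
    rewrite sumr_const -mulr_natl -/N.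
    rewrite big_split/= -/(prodK K) -/kappa prod_powR; last by rewrite ltr0n.
    rewrite mulrA -{1}(sqr_sqrtr (ltW N0)); congr (_ * _).
    by rewrite expr2 mulfK// gt_eqF// sqrtr_gt0.
  have -> : x = kappa * y `^ e.
    rewrite /y /Mexp -/(growth_exponent R d q) -/e -powRrM mulVf ?gt_eqF// powRr1//.
    by rewrite mulrC divfK// gt_eqF.
  rewrite mulrCA ltr_pM2l//.
  (* The part [d / 2] of the exponent comes from [sqrt N >= l^(d/2)], the remaining part from the
     amplitudes, as [L >= l]. *)
  apply: (@lt_le_trans _ _ (l%:R `^ e)).
    by rewrite gt0_ltr_powR ?nnegrE// ltW.
  rewrite /e /growth_exponent powRD; last by rewrite (gt_eqF lr0) implybT.
  apply: ler_pM; rewrite ?powR_ge0//.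
    rewrite powRrM powR_mulrn ?(ltW lr0)// powR12_sqrt ?exprn_ge0 ?(ltW lr0)//.
    by rewrite ler_wsqrtr.
  rewrite ge0_ler_powR ?nnegrE ?(ltW lr0)//; last by rewrite ler_nat leq_pmull.
  apply: sumr_ge0 => m _; move: (q0 m); case: (q m) => [r| |]//=.
  by rewrite lte_fin => /ltW; rewrite invr_ge0.
have fF := atom_filtrationP E subE.
have md m : is_mart_diff P (atom_filtration E) (fun i => xi i m).
  exact: (atom_step_mart_diff P E p mE subE PE).
have main : ((expR (- (4 * d%:R * y)))%:E <= Ttail P (Qd b xi) x)%E.
  rewrite /Ttail le_max; apply/orP; left.
  have mQ : measurable_fun setT (Qd b xi) by exact: (measurable_Qd _ _ _ _ P _ b xi fF md).
  apply: (@le_trans _ _ (P (E n))); last first.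
    apply: le_measure; [rewrite inE; exact: mE|rewrite inE; exact: measurable_gt|].
    exact: QE.
  rewrite PE lee_fin ler_pdivlMr ?exprn_gt0//.
  (* Since [2 <= e], the event [E n] has mass at least [exp(- 2 L)], and [2 L = 2 d l <= 4 d y]. *)
  have : 2 ^+ n <= expR L.
    rewrite -[L]mulr1 expRM_natl; apply: lerXn2r; rewrite ?nnegrE ?expR_ge0//.
    by apply: le_trans (expR_ge1Dx 1); rewrite -natr1.
  move=> /(ler_wpM2l (expR_ge0 (- (4 * d%:R * y)))) /le_trans; apply.
  rewrite /p -expRD ler_expR /L natrM.
  have := ler_wpM2l (ler0n R d) ly; lra.
apply: le_trans main _; apply: ereal_sup_ubound.
exists _, _, P, (atom_filtration E), xi, n, b; split => //.
- move=> m i z i1 z0; exact: (atom_step_tail P E p mE subE PE).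
- rewrite /in_B (eq_bigr (fun=> (Num.sqrt N)^-1 ^+ 2))// sumr_const -/N
     -mulr_natl exprVn sqr_sqrtr ?(ltW N0)//.
  by rewrite mulfV// gt_eqF.
Qed.

Theorem theorem1 (R : realType) (d : nat) (q : 'I_d -> \bar R) :
  (1 <= d)%N -> (forall m, (0 < q m)%E) ->
  exists C1 C2 x0 : R, [/\ 0 < C1, 0 < C2, 0 < x0 &
    forall K : 'I_d -> R, (forall m, 0 < K m) ->
    forall x : R, x0 * prodK K < x ->
      ((expR (- ((x / (C1 * prodK K)) `^ (Mexp q))))%:E <= Ssup q K x)%E /\
      (Ssup q K x <= (expR (- ((x / (C2 * prodK K)) `^ (Mexp q))))%:E)%E].
Proof.
move=> d1 q0; have [c c1 upper] := Ssup_upper R d q d1 q0.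
have c0 : 0 < c by exact: lt_le_trans c1.
have e0 := growth_exponent_gt0 R d q d1 q0.
have a0 : 0 < 4 * d%:R :> R by rewrite mulr_gt0// ltr0n.
(* [C1] is chosen so that its power [M] turns into the factor [4 d] of the lower bound. The
   threshold [c >= 1] also ensures [prodK K <= x], as that bound requires. *)
exists ((4 * d%:R) `^ growth_exponent R d q)^-1, c, c.
split => //; first by rewrite invr_gt0 powR_gt0.
move=> K K0 x cx; split; last exact: upper.
have ka0 := prodK_gt0 R d K K0.
have kx : prodK K <= x by apply: le_trans (ltW cx); rewrite ler_peMl// ltW.
have x0 : 0 <= x / prodK K by rewrite divr_ge0 ?(ltW ka0)// (le_trans (ltW ka0)).
set a : R := 4 * d%:R in a0 *; set e := growth_exponent R d q in e0 *.
have -> : x / ((a `^ e)^-1 * prodK K) = a `^ e * (x / prodK K).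
  by rewrite invfM invrK mulrCA.
have -> : (a `^ e * (x / prodK K)) `^ Mexp q = a * (x / prodK K) `^ Mexp q.
  rewrite (powRM _ (powR_ge0 _ _) x0); congr (_ * _).
  by rewrite -powRrM [e * _]mulfV ?gt_eqF// powRr1// ltW.
exact: Ssup_lower.
Qed.
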